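(* Under $Uf=\lambda^{1/2}f$, the incoming and outgoing amplitudes of $E_s^{\mathrm{hol}}(b)$ (the coefficients of $\zeta^n$ and $\zeta^{-n}$ of $UE_s^{\mathrm{hol}}(b)$ on the cusps) are $K_{\mathrm{in}}(\zeta)b$ and $K_{\mathrm{out}}(\zeta)\Phi(s)b$, where $$K_{\mathrm{in}}(\zeta)=\sqrt{q+1}\,c_{\mathrm{in}}(\zeta)W^{1/2},\qquad K_{\mathrm{out}}(\zeta)=\sqrt{q+1}\,c_{\mathrm{out}}(\zeta)W^{1/2}.$$ Consequently $$\Phi(s)=\frac{c_{\mathrm{in}}(\zeta)}{c_{\mathrm{out}}(\zeta)}W^{-1/2}S(\zeta)W^{1/2}.$$ Away from the zeros of $c_{\mathrm{in}}$, define $\mathcal E_s=E_s^{\mathrm{hol}}c_{\mathrm{in}}(\zeta)^{-1}$. Its cusp expansion is $$\mathcal E_s(b)(c,n)=q^{ns}b_c+q^{n(1-s)}\bigl(\mathcal S_{\mathrm{aut}}(s)b\bigr)_c,$$ where $$\mathcal S_{\mathrm{aut}}(s)=\frac{c_{\mathrm{out}}(\zeta)}{c_{\mathrm{in}}(\zeta)}\Phi(s)=W^{-1/2}S(\zeta)W^{1/2}.$$ The definition of $\mathcal E_s$ and the last two formulas continue meromorphically across the singular parameters. At every point $s=\frac12+\frac{i\theta}{\log q}$, $0<\theta<\pi$, at which the continued matrices are holomorphic, both $\Phi(s)$ and $\mathcal S_{\mathrm{aut}}(s)$ are unitary for the inner product $\langle b_1,b_2\rangle_W=\sum_{c=1}^rw_c(b_1)_c\overline{(b_2)_c}$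 and satisfy $$\Phi(1-s)\Phi(s)=I_r,\qquad \mathcal S_{\mathrm{aut}}(1-s)\mathcal S_{\mathrm{aut}}(s)=I_r .$$ At a removable singularity the same assertions hold after taking the holomorphic continuation.
   Context: Let $q$ be a prime power, $a=\sqrt q$, $K=\mathbb F_q(\!(t^{-1})\!)$, $\mathcal T$ the $(q+1)$-regular Bruhat–Tits tree of $\mathrm{PGL}_2(K)$, $\Gamma<\mathrm{PGL}_2(K)$ a non-uniform arithmetic lattice, and $Y=\Gamma\backslash\mathcal T$. For a quotient vertex $v$ with lift $\widetilde v$ let $\Gamma_v=\operatorname{Stab}_\Gamma(\widetilde v)$ and $\lambda(v)=|\Gamma_v|^{-1}$; $L^2(Y,\lambda)$ has norm $\|f\|^2=\sum_v|f(v)|^2\lambda(v)$. The adjacency operator is $(Af)(v)=\sum_e[\Gamma_v:\Gamma_e]f(t(e))$, the sum over representatives $e$ of $\Gamma_v$-orbits of oriented tree edges issuing from $\widetilde v$, $\Gamma_e=\operatorname{Stab}_{\Gamma_v}(e)$, $t(e)$ the terminal quotient vertex; it is bounded and self-adjoint on $L^2(Y,\lambda)$ and is also applied to arbitrary functions on $V(Y)$. $Y$ has $r$ cusps; they are cut in their homogeneous part, so that $V(Y)$ is the disjoint union of a finite core of $d\ge1$ vertices and rays of vertices $(c,n)$, $1\le c\le r$, $n\ge1$, increasing away from the core, with $(Af)(c,n)=qf(c,n-1)+f(c,n+1)$ for $n\ge2$, $(c,1)$ joined only to the core and (with index $1$) to $(c,2)$, and $\lambda(c,n)=w_c(q+1)q^{-n}$.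 The number $w_c>0$ is the cusp width; $W=\operatorname{diag}(w_1,\dots,w_r)$. Let $Uf=\lambda^{1/2}f$. Then $J=UAU^{-1}$ acts on $\ell^2(V(Y))=\mathbb C^d\oplus\bigoplus_{c=1}^r\ell^2(\mathbb N)$ as $J(u,g)=(H_Cu+Vg(1),h)$, $h(1)=ag(2)+V^*u$, $h(n)=a\{g(n-1)+g(n+1)\}$ ($n\ge2$), where $g(n)\in\mathbb C^r$; this defines the Hermitian matrix $H_C$ and the linear map $V:\mathbb C^r\to\mathbb C^d$. For $\zeta\in\mathbb C^\times$ set $x(\zeta)=a(\zeta+\zeta^{-1})$, $$F(\zeta)=H_C-x(\zeta)I_d+\frac{\zeta^{-1}}aVV^*,\qquad S(\zeta)=-I_r+\frac{\zeta^{-1}-\zeta}aV^*F(\zeta)^{-1}V .$$ Throughout $\zeta=q^{s-1/2}$, so $q^s+q^{1-s}=x(\zeta)$. Put $$\psi_s^{\mathrm{in}}(n)=q^{ns}(q^{s-1}-q^{1-s}),\quad \psi_s^{\mathrm{out}}(n)=q^{n(1-s)}(q^s-q^{-s}),\quad c_{\mathrm{in}}(\zeta)=\frac\zeta a-a\zeta^{-1},\quad c_{\mathrm{out}}(\zeta)=a\zeta-\frac{\zeta^{-1}}a .$$ For $b\in\mathbb C^r$, $E_s^{\mathrm{hol}}(b)$ is the generalized eigenfunction of $A$ with eigenvalue $q^s+q^{1-s}$ having cusp expansion $$E_s^{\mathrm{hol}}(b)(c,n)=b_c\psi_s^{\mathrm{in}}(n)+(\Phi(s)b)_c\psi_s^{\mathrm{out}}(n),$$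 which defines the $r\times r$ matrix $\Phi(s)$; existence and uniqueness hold away from a discrete singular set, and elsewhere meromorphic continuation is meant. *)

(* Defs.v *)
From HB Require Import structures.
From mathcomp Require Import all_boot all_order all_algebra.
From mathcomp Require Import all_classical all_reals all_analysis.
From mathcomp Require Import finmap complex.

Set Implicit Arguments.
Unset Strict Implicit.
Unset Printing Implicit Defensive.

Import Order.TTheory GRing.Theory Num.Theory.
Import numFieldNormedType.Exports.

Local Open Scope classical_set_scope.
Local Open Scope ring_scope.
Local Open Scope complex_scope.

(* Formal power series over F; pcoef f n is the coefficient of the n-th power of
   the variable, which stands for t^-1 below. *)
Record pseries (F : fieldType) := PSeries { pcoef : nat -> F }.

HB.instance Definition _ (F : fieldType) := [isNew for @pcoef F].
HB.instance Definition _ (F : fieldType) := [Choice of pseries F by <:].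

Section PowerSeries.
Variable F : fieldType.
Implicit Types f g h : pseries F.

Definition ps0 : pseries F := PSeries (fun=> 0).
Definition ps1 : pseries F := PSeries (fun n => (n == 0%N)%:R).
Definition psopp f : pseries F := PSeries (fun n => - pcoef f n).
Definition psadd f g : pseries F := PSeries (fun n => pcoef f n + pcoef g n).
Definition psmul f g : pseries F :=
  PSeries (fun n => \sum_(i < n.+1) pcoef f i * pcoef g (n - i)%N).

Lemma pseriesP f g : (forall n, pcoef f n = pcoef g n) -> f = g.
Proof. by case: f g => [f] [g] /= fg; congr PSeries; apply/funext. Qed.

Definition pstrunc (n : nat) f : {poly F} := \poly_(i < n.+1) pcoef f i.

Lemma coef_pstrunc n f i : (i <= n)%N -> (pstrunc n f)`_i = pcoef f i.
Proof. by move=> le_in; rewrite coef_poly ltnS le_in. Qed.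

Lemma pcoef_mul_trunc n m f g : (m <= n)%N ->
  pcoef (psmul f g) m = (pstrunc n f * pstrunc n g)`_m.
Proof.
move=> le_mn; rewrite coefM; apply: eq_bigr => i _.
have le_im : (i <= m)%N by rewrite -ltnS.
by rewrite !coef_pstrunc // ?(leq_trans le_im) // (leq_trans (leq_subr _ _)).
Qed.

Lemma psaddA : associative psadd.
Proof. by move=> f g h; apply: pseriesP => n /=; rewrite addrA. Qed.
Lemma psaddC : commutative psadd.
Proof. by move=> f g; apply: pseriesP => n /=; rewrite addrC. Qed.
Lemma psadd0 : left_id ps0 psadd.
Proof. by move=> f; apply: pseriesP => n /=; rewrite add0r. Qed.
Lemma psaddN : left_inverse ps0 psopp psadd.
Proof. by move=> f; apply: pseriesP => n /=; rewrite addNr. Qed.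

HB.instance Definition _ :=
  GRing.isZmodule.Build (pseries F) psaddA psaddC psadd0 psaddN.

Lemma psmulC : commutative psmul.
Proof.
by move=> f g; apply: pseriesP => n; rewrite !(pcoef_mul_trunc _ _ (leqnn n)) mulrC.
Qed.

Lemma psmulA : associative psmul.
Proof.
move=> f g h; apply: pseriesP => n.
transitivity ((pstrunc n f * (pstrunc n g * pstrunc n h))`_n).
  rewrite coefM; apply: eq_bigr => i _.
  have le_in : (i <= n)%N by rewrite -ltnS.
  by rewrite (coef_pstrunc _ le_in) (@pcoef_mul_trunc n) ?leq_subr.
rewrite mulrA coefM; apply: eq_bigr => i _.
have le_in : (i <= n)%N by rewrite -ltnS.
by rewrite coef_pstrunc ?leq_subr // (@pcoef_mul_trunc n).
Qed.

Lemma psmul1 : left_id ps1 psmul.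
Proof.
move=> f; apply: pseriesP => n /=.
rewrite big_ord_recl /= mul1r subn0 big1 ?addr0 // => i _.
by rewrite mul0r.
Qed.

Lemma psmulDl : left_distributive psmul psadd.
Proof.
move=> f g h; apply: pseriesP => n /=.
by rewrite -big_split; apply: eq_bigr => i _; rewrite mulrDl.
Qed.

Lemma ps1_neq0 : ps1 != ps0.
Proof.
apply/eqP => /(congr1 (fun f => pcoef f 0%N)) /= /eqP.
by rewrite oner_eq0.
Qed.

HB.instance Definition _ := GRing.Zmodule_isComNzRing.Build (pseries F)
  psmulA psmulC psmul1 psmulDl ps1_neq0.

Definition psunit : pred (pseries F) := fun f => `[< exists g, g * f = 1 >].
Definition psinv f : pseries F := xget f [set g | g * f = 1].

Lemma psmulV : {in psunit, left_inverse 1 psinv *%R}.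
Proof.
move=> f /asboolP[g gf]; rewrite /psinv.
by case: xgetP => [h _ //|/(_ g)].
Qed.

Lemma psunitP f g : g * f = 1 -> psunit f.
Proof. by move=> gf; apply/asboolP; exists g. Qed.

Lemma psinv_out : {in [predC psunit], psinv =1 id}.
Proof.
move=> f /negP nf; rewrite /psinv.
case: xgetP => [h _ hf|//]; case: nf; exact: (psunitP hf).
Qed.

HB.instance Definition _ := GRing.ComNzRing_hasMulInverse.Build (pseries F)
  psmulV psunitP psinv_out.

Lemma ps_neq0_lead f : f != 0 ->
  exists2 m, pcoef f m != 0 & forall i, (i < m)%N -> pcoef f i = 0.
Proof.
move=> f0; have exm : exists m, pcoef f m != 0.
  apply: contrapT => nex; case/eqP: f0; apply: pseriesP => n.
  by apply/eqP; apply: contrapT => /negP fn; apply: nex; exists n.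
exists (ex_minn exm); case: ex_minnP => // m _ minm i lt_im.
by apply/eqP; apply: contraLR lt_im => fi; rewrite -leqNgt minm.
Qed.

Lemma psmul_eq0 (f g : pseries F) : f * g = 0 -> (f == 0) || (g == 0).
Proof.
move=> fg0; apply/negPn/negP; rewrite negb_or => /andP[f0 g0].
have [m fm ltm] := ps_neq0_lead f0; have [n gn ltn] := ps_neq0_lead g0.
have := congr1 (fun h => pcoef h (m + n)%N) fg0; rewrite /=.
have lt_m : (m < (m + n).+1)%N by rewrite ltnS leq_addr.
rewrite (bigD1 (Ordinal lt_m)) //= big1 ?addr0 => [|i /eqP ne_im].
  by rewrite addKn => /eqP; rewrite mulf_eq0 (negbTE fm) (negbTE gn).
have [/ltm-> |le_mi] := ltnP i m; first by rewrite mul0r.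
rewrite [X in _ * X]ltn ?mulr0 //.
have lt_mi : (m < i)%N.
  rewrite ltn_neqAle le_mi andbT; apply/eqP => e.
  by apply: ne_im; apply: val_inj.
have le_i : (i <= m + n)%N by rewrite -ltnS.
by rewrite ltn_subLR // ltn_add2r.
Qed.

HB.instance Definition _ := GRing.ComUnitRing_isIntegral.Build (pseries F)
  psmul_eq0.

End PowerSeries.

(* F((t^-1)) is the fraction field of F[[t^-1]]. *)
Definition laurent (F : fieldType) : fieldType := {fraction (pseries F)}.

Section Tree.
Variable F : fieldType.
Local Notation K := (laurent F).

Definition valuation_ring : set K := range (@tofrac (pseries F)).

Definition uniformizer : K := tofrac (PSeries (fun n => (n == 1%N)%:R)).

Definition std_lattice : set 'cV[K]_2 :=
  [set x | forall i, valuation_ring (x i 0)].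

Definition is_lattice (L : set 'cV[K]_2) : Prop :=
  exists2 g : 'M[K]_2, g \in unitmx & L = [set g *m x | x in std_lattice].

Definition homothety (c : K) (L : set 'cV[K]_2) : set 'cV[K]_2 :=
  [set c *: x | x in L].

(* Vertices of the Bruhat-Tits tree are homothety classes of lattices; a class
   is represented by the set of its members, and tree_vertex singles the
   vertices out among all sets of subsets of K^2. *)
Definition vclass := set (set 'cV[K]_2).

Definition tree_vertex : set vclass :=
  [set [set homothety c L | c in [set c | c != 0]] | L in is_lattice].

Definition tree_adj (x y : vclass) : Prop :=
  exists L L', [/\ x L, y L', homothety uniformizer L `<` L' & L' `<` L].

Definition act (g : 'M[K]_2) (x : vclass) : vclass :=
  [set [set g *m v | v in L] | L in x].

(* A subgroup of PGL_2(K) is represented by its full preimage in GL_2(K). *)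
Definition pgl_subgroup (G : set 'M[K]_2) : Prop :=
  [/\ forall g, G g -> g \in unitmx,
      forall c : K, c != 0 -> G c%:M,
      forall g h, G g -> G h -> G (g *m h)
    & forall g, G g -> G (invmx g)].

Definition pgl_class (g : 'M[K]_2) : set 'M[K]_2 :=
  [set c *: g | c in [set c | c != 0]].

(* Cardinality of a finite set; infinite sets get 0. *)
Definition ncard (T : choiceType) (A : set T) : nat := #|` fset_set A|%fset.

Definition pgl_order (G : set 'M[K]_2) : nat := ncard (pgl_class @` G).

Definition lcosets (G H : set 'M[K]_2) : set (set 'M[K]_2) :=
  [set [set g *m h | h in H] | g in G].

Definition gindex (G H : set 'M[K]_2) : nat := ncard (lcosets G H).

Definition orb (G : set 'M[K]_2) (x : vclass) : set vclass :=
  [set act g x | g in G].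

Definition stab (G : set 'M[K]_2) (x : vclass) : set 'M[K]_2 :=
  [set g | G g /\ act g x = x].

Definition representative (X : set vclass) : vclass := xget set0 X.

Definition quotient_vertices (G : set 'M[K]_2) : set (set vclass) :=
  [set orb G x | x in tree_vertex].

(* Tree lattices in the sense of Bass and Lubotzky: discreteness is finiteness
   of the vertex stabilizers, the covolume is the sum of 1/|G_v| over the
   quotient, and the lattice is non-uniform when the quotient is infinite. *)
Definition nonuniform_lattice (R : realType) (G : set 'M[K]_2) : Prop :=
  [/\ forall x, tree_vertex x -> finite_set (pgl_class @` stab G x),
      (\esum_(X in quotient_vertices G)
         ((pgl_order (stab G (representative X)))%:R^-1 : R)%:E < +oo)%E
    & infinite_set (quotient_vertices G)].

Definition is_subfield (k : set K) : Prop :=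
  [/\ k 1, forall x y, k x -> k y -> k (x - y),
      forall x y, k x -> k y -> k (x * y)
    & forall x, k x -> k x^-1].

(* The subfield generated by x over the prime field. *)
Definition prime_field_adjoin (x : K) : set K :=
  [set y | exists P Q : {poly int}, (map_poly intr Q).[x] != 0 /\
     y = (map_poly intr P).[x] / (map_poly intr Q).[x]].

Definition global_function_field (k : set K) : Prop :=
  is_subfield k /\
  exists x, [/\ k x,
    forall P : {poly int}, (map_poly intr P : {poly K}).[x] = 0 ->
      map_poly intr P = 0 :> {poly K}
  & exists (n : nat) (b : 'I_n -> K), (forall i, k (b i)) /\
      forall y, k y -> exists c : 'I_n -> K,
        (forall i, prime_field_adjoin x (c i)) /\ y = \sum_i c i * b i].

(* K is then the completion of k at the place cut out by valuation_ring. *)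
Definition dense_subfield (k : set K) : Prop :=
  forall x n, exists2 y, k y & valuation_ring ((x - y) / uniformizer ^+ n).

Definition valuation_subring (k V : set K) : Prop :=
  [/\ V `<=` k, V 1, forall x y, V x -> V y -> V (x - y),
      forall x y, V x -> V y -> V (x * y)
    & forall x, k x -> V x \/ V x^-1].

(* Elements of k regular at every place other than the distinguished one. The
   places of k are its proper valuation subrings; V = k imposes nothing. *)
Definition regular_functions (k : set K) : set K :=
  [set x | k x /\ forall V, valuation_subring k V ->
     V <> k `&` valuation_ring -> V x].

Definition pgl2_over (A : set K) : set 'M[K]_2 :=
  [set M | exists c g, [/\ c != 0, g \in unitmx,
     forall i j, A (g i j) /\ A (invmx g i j) & M = c *: g]].

Definition commensurable (G H : set 'M[K]_2) : Prop :=
  finite_set (lcosets G (G `&` H)) /\ finite_set (lcosets H (G `&` H)).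

(* Over a function field a non-uniform arithmetic lattice comes from an
   isotropic form, i.e. from PGL_2 itself, with a single place removed. *)
Definition arithmetic (G : set 'M[K]_2) : Prop :=
  exists (k : set K) (h : 'M[K]_2),
    [/\ global_function_field k, dense_subfield k, h \in unitmx
      & commensurable G
          [set h *m g *m invmx h | g in pgl2_over (regular_functions k)]].

Definition nonuniform_arithmetic_lattice (R : realType) (G : set 'M[K]_2) :=
  [/\ pgl_subgroup G, nonuniform_lattice R G & arithmetic G].

End Tree.

(* A numFieldType-typed copy of R[i], on which the library's topology and
   (complex) derivative are found. *)
Definition Cx (R : realType) : numClosedFieldType := R[i].

(* Vertices of the cut quotient: inl i is a core vertex and inr (c, m) is the
   ray vertex (c, m + 1). *)
Definition qvert (d r : nat) := ('I_d + 'I_r * nat)%type.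

Definition core {d r : nat} (i : 'I_d) : qvert d r := inl i.

(* The ray vertex (c, n), for n >= 1. *)
Definition ray {d r : nat} (c : 'I_r) (n : nat) : qvert d r := inr (c, n.-1).

Section Quotient.
Variables (R : realType) (F : finFieldType) (d r : nat).
Variables (G : set 'M[laurent F]_2) (lift : qvert d r -> vclass F).
Local Notation C := (Cx R).
Local Notation Y := (qvert d r).

Definition qweight (v : Y) : R := (pgl_order (stab G (lift v)))%:R^-1.

(* The value of f at the image in the quotient of the tree vertex y. *)
Definition pullback (f : Y -> C) (y : vclass F) : C :=
  xget 0 [set f v | v in [set v | orb G (lift v) y]].

(* An oriented edge issuing from x is given by its terminal vertex. *)
Definition edge_orbits (x : vclass F) : set (set (vclass F)) :=
  [set orb (stab G x) y | y in [set y | tree_vertex y /\ tree_adj x y]].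

Definition edge_index (x y : vclass F) : nat :=
  gindex (stab G x) (stab (stab G x) y).

Definition adjacency (f : Y -> C) (v : Y) : C :=
  \sum_(X \in edge_orbits (lift v))
    (edge_index (lift v) (representative X))%:R * pullback f (representative X).

Record cusp_decomposition (w : 'I_r -> R) : Prop := CuspDecomposition {
  cd_vertex : forall v, tree_vertex (lift v);
  cd_surj : forall x, tree_vertex x -> exists v, orb G (lift v) x;
  cd_inj : forall u v, orb G (lift u) (lift v) -> u = v;
  cd_width_gt0 : forall c, 0 < w c;
  cd_weight : forall c n, (1 <= n)%N ->
    qweight (ray c n) = w c * (#|F|.+1)%:R * #|F|%:R ^- n;
  cd_adjacency : forall f c n, (2 <= n)%N ->
    adjacency f (ray c n) = #|F|%:R * f (ray c n.-1) + f (ray c n.+1);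
  cd_first : forall c, exists y,
    [/\ tree_adj (lift (ray c 1)) y, orb G (lift (ray c 2)) y,
        edge_index (lift (ray c 1)) y = 1%N
      & forall z, tree_vertex z -> tree_adj (lift (ray c 1)) z -> z <> y ->
          exists i, orb G (lift (core i)) z] }.

Definition Uop (f : Y -> C) (v : Y) : C := (Num.sqrt (qweight v))%:C * f v.

Definition Uinv (g : Y -> C) (v : Y) : C := (Num.sqrt (qweight v))%:C^-1 * g v.

Definition Jop (g : Y -> C) : Y -> C := Uop (adjacency (Uinv g)).

Definition qdelta (u : Y) : Y -> C := fun v => (v == u)%:R.

Definition coreH : 'M[C]_d := \matrix_(i, j) Jop (qdelta (core j)) (core i).

Definition coreV : 'M[C]_(d, r) :=
  \matrix_(i, c) Jop (qdelta (ray c 1)) (core i).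

Definition sqrtq : C := (Num.sqrt #|F|%:R : R)%:C.

Definition xpar (z : C) : C := sqrtq * (z + z^-1).

Definition adjoint m n (M : 'M[C]_(m, n)) : 'M[C]_(n, m) :=
  map_mx Num.conj M^T.

Definition Fmx (z : C) : 'M[C]_d :=
  coreH - (xpar z)%:M + (z^-1 / sqrtq) *: (coreV *m adjoint coreV).

Definition Smx (z : C) : 'M[C]_r :=
  - 1%:M + ((z^-1 - z) / sqrtq) *: (adjoint coreV *m invmx (Fmx z) *m coreV).

(* q^s for complex s. *)
Definition qpow (s : C) : C :=
  let l : R := ln #|F|%:R in
  (expR (complex.Re s * l))%:C *
    (cos (complex.Im s * l) +i* sin (complex.Im s * l)).

Definition zeta (s : C) : C := qpow (s - 2^-1).

Definition psi_in (s : C) (n : nat) : C :=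
  qpow (n%:R * s) * (qpow (s - 1) - qpow (1 - s)).

Definition psi_out (s : C) (n : nat) : C :=
  qpow (n%:R * (1 - s)) * (qpow s - qpow (- s)).

Definition c_in (z : C) : C := z / sqrtq - sqrtq * z^-1.

Definition c_out (z : C) : C := sqrtq * z - z^-1 / sqrtq.

Definition Whalf (w : 'I_r -> R) : 'M[C]_r :=
  diag_mx (\row_c (Num.sqrt (w c))%:C).

Definition inner_W (w : 'I_r -> R) (b1 b2 : 'cV[C]_r) : C :=
  \sum_c (w c)%:C * b1 c 0 * Num.conj (b2 c 0).

Definition unitary_W (w : 'I_r -> R) (M : 'M[C]_r) : Prop :=
  forall b1 b2, inner_W w (M *m b1) (M *m b2) = inner_W w b1 b2.

Definition K_in (w : 'I_r -> R) (z : C) : 'M[C]_r :=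
  ((Num.sqrt (#|F|.+1)%:R : R)%:C * c_in z) *: Whalf w.

Definition K_out (w : 'I_r -> R) (z : C) : 'M[C]_r :=
  ((Num.sqrt (#|F|.+1)%:R : R)%:C * c_out z) *: Whalf w.

(* p and p' are the coefficients of z^n and z^-n of g on the cusps. *)
Definition amplitudes (z : C) (g : Y -> C) (p p' : 'cV[C]_r) : Prop :=
  forall c n, (1 <= n)%N -> g (ray c n) = p c 0 * z ^+ n + p' c 0 * z ^- n.

End Quotient.

Section Meromorphic.
Variable R : realType.
Local Notation C := (Cx R).

Definition holomorphic_at (f : C -> C) (z : C) : Prop :=
  \forall w \near z, derivable f w 1.

Definition meromorphic (f : C -> C) : Prop :=
  forall z, exists (n : nat) (g : C -> C), holomorphic_at g z /\
    \forall w \near z^', (w - z) ^+ n * f w = g w.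

(* No accumulation point anywhere in C. *)
Definition discrete (D : set C) : Prop := forall z, \forall w \near z^', ~ D w.

(* Equality of meromorphic functions, i.e. off a discrete set. *)
Definition mero_eq (T : Type) (f g : C -> T) : Prop :=
  discrete [set s | f s <> g s].

(* f with its removable singularities removed: the value at z is that of the
   holomorphic continuation to z whenever there is one. *)
Definition continued (f : C -> C) (z : C) : C :=
  xget (f z) [set g z | g in
    [set g | holomorphic_at g z /\ \forall w \near z^', f w = g w]].

Definition is_continuation (f : C -> C) : Prop :=
  meromorphic f /\ continued f = f.

Definition mx_holomorphic_at m n (M : C -> 'M[C]_(m, n)) (z : C) : Prop :=
  forall i j, holomorphic_at (fun s => M s i j) z.

Definition mx_is_continuation m n (M : C -> 'M[C]_(m, n)) : Prop :=
  forall i j, is_continuation (fun s => M s i j).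

Definition mx_continued m n (M : C -> 'M[C]_(m, n)) (z : C) : 'M[C]_(m, n) :=
  \matrix_(i, j) continued (fun s => M s i j) z.

End Meromorphic.

Section Eisenstein.
Variables (R : realType) (F : finFieldType) (d r : nat).
Variables (G : set 'M[laurent F]_2) (lift : qvert d r -> vclass F).
Local Notation C := (Cx R).
Local Notation Y := (qvert d r).

Definition has_cusp_expansion (s : C) (f : Y -> C) (b p : 'cV[C]_r) : Prop :=
  forall c n, (1 <= n)%N ->
    f (ray c n) = b c 0 * psi_in F s n + p c 0 * psi_out F s n.

Definition eisenstein_solution (s : C) (b : 'cV[C]_r) (f : Y -> C)
    (p : 'cV[C]_r) : Prop :=
  (forall v, adjacency G lift f v = (qpow F s + qpow F (1 - s)) * f v) /\
  has_cusp_expansion s f b p.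

(* E s b is the generalized eigenfunction and Phi s the scattering matrix: off a
   discrete set they are the unique solution, and at the other parameters they
   are given by meromorphic continuation, removable singularities removed. *)
Record is_eisenstein (E : C -> 'cV[C]_r -> Y -> C) (Phi : C -> 'M[C]_r) :
    Prop := IsEisenstein {
  eis_E : forall b v, is_continuation (fun s => E s b v);
  eis_Phi : mx_is_continuation Phi;
  eis_solution : exists2 D, discrete D & forall s, ~ D s -> forall b,
    eisenstein_solution s b (E s b) (Phi s *m b) /\
    forall f p, eisenstein_solution s b f p -> f = E s b /\ p = Phi s *m b }.

Definition calE (E : C -> 'cV[C]_r -> Y -> C) (s : C) (b : 'cV[C]_r) (v : Y) :
    C :=
  continued (fun s' => E s' b v * (c_in F (zeta F s'))^-1) s.

Definition S_aut (Phi : C -> 'M[C]_r) : C -> 'M[C]_r :=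
  mx_continued
    (fun s => (c_out F (zeta F s) / c_in F (zeta F s)) *: Phi s).

Definition WSW (w : 'I_r -> R) (s : C) : 'M[C]_r :=
  invmx (Whalf w) *m Smx G lift (zeta F s) *m Whalf w.

End Eisenstein.

(* Main.v *)
Require Import Defs.
From HB Require Import structures.
From mathcomp Require Import all_boot all_order all_algebra.
From mathcomp Require Import all_classical all_reals all_analysis.
From mathcomp Require Import finmap complex ring lra.

Set Implicit Arguments.
Unset Strict Implicit.
Unset Printing Implicit Defensive.

Import Order.TTheory GRing.Theory Num.Theory.
Import numFieldNormedType.Exports.

Local Open Scope classical_set_scope.
Local Open Scope ring_scope.
Local Open Scope complex_scope.

(** Discreteness of the lattice makes the number of neighbours of one quotient
    vertex lying above another symmetric up to the weights, so [J] has real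
    symmetric matrix entries, [H_C] is Hermitian and [V] couples the core and
    the first ray vertices both ways.  The eigenvalue equation at the core reads
    [F(z) u = (z^-1 - z) V p], and at the first ray vertices [V^* u = a (p + p')],
    where [p] and [p'] are the incoming and outgoing amplitudes; hence
    [p' = S(z) p] wherever [F(z)] is invertible.  Since [F(z) = z P(1/z)] with
    [P] a matrix polynomial such that [P(0) = - a I], this fails only on a
    discrete set of [s], and all identities extend by continuation.

    The resolvent identity gives [S(1/z) S(z) = I], and [S(z)^* = S(conj z)]
    since [H_C] is Hermitian.  On the line [Re s = 1/2], where [conj z = 1/z],
    this is unitarity off the singular set; unitarity passes to every point [s]
    of the line at which the matrix is holomorphic.  There the matrix is thus
    invertible, so its inverse at [s] provides the holomorphic continuation to
    [1 - s], which yields the functional equation. *)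

(** * Holomorphic and meromorphic functions *)

Section Holomorphy.
Variable R : realType.
Local Notation C := (Cx R).
Implicit Types (f g h : C -> C) (z w : C).

Lemma nbhs_neq w z : w != z -> \forall u \near w, u != z.
Proof.
move=> wz; apply: (@open_nbhs_nbhs C w [set u | u != z]); split => //.
rewrite (_ : [set u | u != z] = ~` [set z]).
  apply: closed_openC; apply: accessible_closed_set1.
  exact: hausdorff_accessible (@norm_hausdorff _ C).
by apply/seteqP; split => u /= /eqP.
Qed.

Lemma near_dnbhs z (P : set C) : (\forall w \near z, P w) -> \forall w \near z^', P w.
Proof. exact: nbhs_dnbhs. Qed.

(** A punctured disc is open, so each of its points has a full neighbourhood inside it. This turns
    equalities off [z] into local equalities at the nearby points, as differentiability requires. *)
Lemma dnbhs_near z (P : set C) : (\forall w \near z^', P w) ->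
  \forall w \near z^', \forall u \near w, P u.
Proof.
rewrite /dnbhs /within /= => zP.
have zP' := @nbhs_interior C z _ zP.
apply: (@filterS C (nbhs z) _ _ _ _ zP') => w zPw wz.
apply: (@filterS2 C (nbhs w) _ _ _ _ _ zPw (nbhs_neq wz)) => u; exact.
Qed.

Lemma dnbhs_nbhs z (P : set C) : P z -> (\forall w \near z^', P w) -> \forall w \near z, P w.
Proof.
move=> Pz; rewrite /dnbhs /within /= => zP.
by apply: (@filterS C (nbhs z) _ _ _ _ zP) => w zPw; have [->|] := eqVneq w z.
Qed.

Lemma holomorphic_near f z : holomorphic_at f z -> \forall w \near z, holomorphic_at f w.
Proof. exact: nbhs_interior. Qed.

Lemma holomorphic_derivable f z : holomorphic_at f z -> derivable f z 1.
Proof. exact: nbhs_singleton. Qed.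

Lemma holomorphic_continuous f z : holomorphic_at f z -> {for z, continuous f}.
Proof.
by move/holomorphic_derivable/derivable1_diffP/differentiable_continuous.
Qed.

Lemma near_eq_holomorphic f g z :
  (\forall w \near z, f w = g w) -> holomorphic_at f z -> holomorphic_at g z.
Proof.
move=> fg; rewrite /holomorphic_at => hf.
have fg' := @nbhs_interior C z _ fg.
apply: (@filterS2 C (nbhs z) _ _ _ _ _ fg' hf) => w fgw.
by apply: near_eq_derivable.
Qed.

Lemma holomorphic_cst (c : C) z : holomorphic_at (fun=> c) z.
Proof. by apply: filterE => w; exact: derivable_cst. Qed.

Lemma holomorphic_id z : holomorphic_at id z.
Proof. by apply: filterE => w; exact: derivable_id. Qed.

Lemma holomorphicD f g z : holomorphic_at f z -> holomorphic_at g z ->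
  holomorphic_at (fun w => f w + g w) z.
Proof. by apply: filterS2 => w; exact: derivableD. Qed.

Lemma holomorphicN f z : holomorphic_at f z -> holomorphic_at (fun w => - f w) z.
Proof. by apply: filterS => w; exact: derivableN. Qed.

Lemma holomorphicM f g z : holomorphic_at f z -> holomorphic_at g z ->
  holomorphic_at (fun w => f w * g w) z.
Proof. by apply: filterS2 => w; exact: derivableM. Qed.

Lemma continuous_neq f z (c : C) : {for z, continuous f} -> f z != c ->
  \forall w \near z, f w != c.
Proof. by move=> fz fzc; apply: (fz [set u | u != c]); exact: nbhs_neq. Qed.

Lemma holomorphicV f z : holomorphic_at f z -> f z != 0 ->
  holomorphic_at (fun w => (f w)^-1) z.
Proof.
move=> hf fz0; have f0 := continuous_neq (holomorphic_continuous hf) fz0.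
by apply: filterS2 hf f0 => w hf f0; exact: derivableV.
Qed.

Lemma holomorphicX f n z : holomorphic_at f z -> holomorphic_at (fun w => f w ^+ n) z.
Proof.
move=> hf; elim: n => [|n IHn]; first exact: holomorphic_cst.
by under eq_fun do rewrite exprS; exact: holomorphicM.
Qed.

Lemma holomorphic_sum (I : Type) (r : seq I) (P : pred I) (F : I -> C -> C) z :
  (forall i, P i -> holomorphic_at (F i) z) ->
  holomorphic_at (fun w => \sum_(i <- r | P i) F i w) z.
Proof.
move=> hF; elim: r => [|i r IHr].
  by under eq_fun do rewrite big_nil; exact: holomorphic_cst.
under eq_fun do rewrite big_cons.
by case: (boolP (P i)) => [Pi|_]; [exact: holomorphicD (hF i Pi) IHr|exact: IHr].
Qed.

Lemma holomorphic_prod (I : Type) (r : seq I) (P : pred I) (F : I -> C -> C) z :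
  (forall i, P i -> holomorphic_at (F i) z) ->
  holomorphic_at (fun w => \prod_(i <- r | P i) F i w) z.
Proof.
move=> hF; elim: r => [|i r IHr].
  by under eq_fun do rewrite big_nil; exact: holomorphic_cst.
under eq_fun do rewrite big_cons.
by case: (boolP (P i)) => [Pi|_]; [exact: holomorphicM (hF i Pi) IHr|exact: IHr].
Qed.

Lemma continuous_dnbhs_eq f g z : {for z, continuous f} -> {for z, continuous g} ->
  (\forall w \near z^', f w = g w) -> f z = g z.
Proof.
move=> /continuous_withinNx cf /continuous_withinNx cg fg.
apply: (cvg_unique (@norm_hausdorff _ C) cf).
apply: cvg_trans cg; apply: near_eq_cvg.
by apply: filterS fg => w ->.
Qed.

Lemma holomorphic_dnbhs_eq f g z : holomorphic_at f z -> holomorphic_at g z ->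
  (\forall w \near z^', f w = g w) -> f z = g z.
Proof.
move=> /holomorphic_continuous cf /holomorphic_continuous cg.
exact: continuous_dnbhs_eq.
Qed.

(** The choice made by [xget] is harmless: two holomorphic candidates agree on a punctured
    neighbourhood, hence at [z] by continuity. *)
Lemma continuedE f g z : holomorphic_at g z ->
  (\forall w \near z^', f w = g w) -> continued f z = g z.
Proof.
move=> hg fg; rewrite /continued.
case: xgetP => [_ -> [g' [hg' fg'] <-]|/(_ (g z)) []]; last by exists g.
by apply: holomorphic_dnbhs_eq => //; apply: filterS2 fg fg' => w -> ->.
Qed.

Lemma continued_id f z : holomorphic_at f z -> continued f z = f z.
Proof. by move=> hf; apply: continuedE => //; exact: filterE. Qed.

Lemma holomorphic_meromorphic f : (forall z, holomorphic_at f z) -> meromorphic f.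
Proof.
move=> hf z; exists 0%N, f; split=> //.
by apply: filterE => w; rewrite expr0 mul1r.
Qed.

Lemma meromorphicM f g : meromorphic f -> meromorphic g ->
  meromorphic (fun w => f w * g w).
Proof.
move=> mf mg z; have [m [k [hk fk]]] := mf z; have [n [l [hl gl]]] := mg z.
exists (m + n)%N, (fun w => k w * l w); split; first exact: holomorphicM.
by apply: filterS2 fk gl => w <- <-; rewrite exprD mulrACA.
Qed.

(** Off [z] the factor [(w - z) ^+ n] is invertible, so [f] is locally the quotient of [g] by it. *)
Lemma meromorphic_near_holomorphic f z : meromorphic f ->
  \forall w \near z^', holomorphic_at f w.
Proof.
move=> /(_ z)[n [g [hg fg]]].
have hg' := near_dnbhs (holomorphic_near hg).
have fg' := dnbhs_near fg.
have neq : \forall w \near z^', w != z by exact: nbhs_dnbhs_neq.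
apply: filterS3 hg' fg' neq => w hgw fgw wz.
have hid : holomorphic_at (fun u : C => u - z) w.
  by apply: holomorphicD; [exact: holomorphic_id|exact: holomorphic_cst].
apply: (@near_eq_holomorphic (fun u => ((u - z) ^+ n)^-1 * g u)).
  apply: filterS2 fgw (nbhs_neq wz) => u <- uz.
  by rewrite mulKf // expf_neq0 // subr_eq0.
apply: holomorphicM hgw; apply: (holomorphicV (holomorphicX n hid)).
by rewrite expf_neq0 // subr_eq0.
Qed.

Lemma meromorphic_continued_near f z : meromorphic f ->
  \forall w \near z^', continued f w = f w.
Proof.
move=> /(meromorphic_near_holomorphic z); apply: filterS => w; exact: continued_id.
Qed.

(** Removing singularities changes [f] only on a discrete set, so [f] and [continued f] have the
    same holomorphic candidates at every point. *)
Lemma is_continuation_continued f : meromorphic f -> is_continuation (continued f).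
Proof.
move=> mf; have cf z := meromorphic_continued_near z mf; split.
  move=> z; have [n [k [hk fk]]] := mf z; exists n, k; split=> //.
  by apply: filterS2 (cf z) fk => w ->.
apply/funext => z.
(* Either the singularity at [z] is removable and both sides are the value of the continuation, or
   there is no candidate and the outer [continued] returns its default [continued f z]. *)
have [[k [hk fk]]|nk] := pselect (exists k, holomorphic_at k z /\
    \forall w \near z^', f w = k w).
  have cfk : \forall w \near z^', continued f w = k w.
    by apply: filterS2 (cf z) fk => w ->.
  by rewrite (continuedE hk cfk) (continuedE hk fk).
rewrite {1}/continued; case: xgetP => // x _ [k [hk fk] kz].
by case: nk; exists k; split => //; apply: filterS2 (cf z) fk => w <-.
Qed.

Lemma discrete_setU (A B : set C) : discrete A -> discrete B -> discrete (A `|` B).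
Proof. by move=> dA dB z; apply: filterS2 (dA z) (dB z) => w nA nB []. Qed.

Lemma sub_discrete (A B : set C) : A `<=` B -> discrete B -> discrete A.
Proof. by move=> AB dB z; apply: filterS (dB z) => w nB /AB. Qed.

End Holomorphy.

(** * The complex exponential [q^s] *)

Section ComplexExponential.
Variables (R : realType) (F : finFieldType).
Local Notation C := (Cx R).

(** The division-free form of the derivative lets real estimates on [expR], [cos] and [sin] be
    transferred to the complex function [qpow]. *)
Lemma is_derive_normP (K : numFieldType) (f : K -> K) (a df : K) :
  is_derive a 1 f df <->
  forall e, 0 < e -> \forall h \near 0^', `|f (h + a) - f a - h * df| <= e * `|h|.
Proof.
have neq : \forall h \near (0 : K)^', h != 0 by exact: nbhs_dnbhs_neq.
have eqn (h : K) : h != 0 ->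
    `|df - h^-1 *: (f (h *: 1 + a) - f a)| * `|h| = `|f (h + a) - f a - h * df|.
  move=> h0; rewrite -normrM -normrN; congr `|_|.
  by rewrite [h *: 1]mulr1 [_ *: _]mulrC mulrBl divfK // opprB [df * h]mulrC.
split=> [[fdf dfE] e e0|fdf].
  have : h^-1 *: (f (h *: 1 + a) - f a) @[h --> 0^'] --> df by rewrite -dfE.
  move=> /cvgrPdist_le /(_ _ e0); apply: filterS2 neq => h h0 He.
  by rewrite -eqn // ler_wpM2r.
have cvf : h^-1 *: (f (h *: 1 + a) - f a) @[h --> 0^'] --> df.
  apply/cvgrPdist_le => e e0; apply: filterS2 neq (fdf _ e0) => h h0.
  by rewrite -eqn // ler_pM2r // normr_gt0.
by apply: DeriveDef; [apply/cvg_ex; exists df|apply: cvg_lim].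
Qed.

Lemma qpowE (s : C) : qpow F s =
  (expR (complex.Re s * ln #|F|%:R))%:C *
    (cos (complex.Im s * ln #|F|%:R) +i* sin (complex.Im s * ln #|F|%:R)).
Proof. by []. Qed.

Lemma mulcE (a b c e : R) :
  (a +i* b : C) * (c +i* e) = (a * c - b * e) +i* (a * e + b * c).
Proof. by []. Qed.

Lemma conjcE (x : C) : Num.conj x = conjc x.
Proof. by []. Qed.

Lemma conj_realC (x : R) : Num.conj (x%:C : C) = x%:C.
Proof. by rewrite conjcE conjc_real. Qed.

Lemma qpowD (s t : C) : qpow F (s + t) = qpow F s * qpow F t.
Proof.
rewrite !qpowE raddfD /=; case: s => sr si; case: t => tr ti /=.
rewrite !mulrDl expRD cosD sinD rmorphM /= mulrACA; congr (_ * _).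
by rewrite mulcE; congr (_ +i* _); rewrite addrC.
Qed.

Lemma qpow0 : qpow F (0 : C) = 1.
Proof. by rewrite qpowE /= !mul0r expR0 cos0 sin0 mul1r. Qed.

Lemma qpow_neq0 (s : C) : qpow F s != 0.
Proof.
apply/eqP => s0; have := qpowD s (- s).
by rewrite subrr qpow0 s0 mul0r => /eqP; rewrite oner_eq0.
Qed.

Lemma qpowN (s : C) : qpow F (- s) = (qpow F s)^-1.
Proof. by apply: (mulfI (qpow_neq0 s)); rewrite -qpowD subrr qpow0 divff ?qpow_neq0. Qed.

Lemma qpow_natM n (s : C) : qpow F (n%:R * s) = qpow F s ^+ n.
Proof.
elim: n => [|n IHn]; first by rewrite mul0r qpow0.
by rewrite -natr1 mulrDl mul1r qpowD IHn exprSr.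
Qed.

Lemma cardF_gt1 : (1 < #|F|)%N.
Proof. exact: card_finNzRing_gt1. Qed.

Lemma lnq_gt0 : 0 < ln (#|F|%:R) :> R.
Proof. by apply: ln_gt0; rewrite ltr1n cardF_gt1. Qed.

Lemma qpow1 : qpow F (1 : C) = #|F|%:R.
Proof.
rewrite qpowE /= mul1r mul0r cos0 sin0 lnK; last first.
  by rewrite posrE ltr0n (ltn_trans _ cardF_gt1).
by rewrite (_ : 1 +i* 0 = 1) // mulr1 rmorph_nat.
Qed.

Lemma sqrtq_gt0 : 0 < sqrtq R F.
Proof. by rewrite /sqrtq ltcR sqrtr_gt0 ltr0n (ltn_trans _ cardF_gt1). Qed.

Lemma sqrtq_neq0 : sqrtq R F != 0.
Proof. by rewrite gt_eqF // sqrtq_gt0. Qed.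

Lemma sqr_sqrtq : sqrtq R F ^+ 2 = #|F|%:R.
Proof. by rewrite /sqrtq -rmorphXn /= sqr_sqrtr ?ler0n // rmorph_nat. Qed.

Lemma qpow_half : qpow F (2^-1 : C) = sqrtq R F.
Proof.
have e : (2^-1 : C) = (2^-1 : R)%:C by rewrite fmorphV rmorph_nat.
rewrite qpowE e /= mul0r cos0 sin0 (_ : 1 +i* 0 = 1) // mulr1 /sqrtq.
congr (_%:C); apply: (@pexpIrn _ 2) => //; rewrite ?nnegrE ?expR_ge0 ?sqrtr_ge0 //.
rewrite sqr_sqrtr ?ler0n // -expRM_natl mulVKf ?pnatr_eq0 //.
by rewrite lnK // posrE ltr0n (ltn_trans _ cardF_gt1).
Qed.

Lemma conj_qpow (s : C) : Num.conj (qpow F s) = qpow F (Num.conj s).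
Proof.
rewrite !qpowE; case: s => x y /=.
rewrite mulNr cosN sinN; apply/eqP; rewrite eq_complex /=.
by rewrite !(mul0r, subr0, addr0, mulrN) !eqxx.
Qed.

Lemma is_derive_bound (f : R -> R) (df e : R) :
  is_derive (0 : R) 1 f df -> 0 < e ->
  exists2 d : R, 0 < d & forall h, `|h| < d -> `|f h - f 0 - h * df| <= e * `|h|.
Proof.
move=> /is_derive_normP fdf e0; have /nbhs_ballP[d /= d0 Hd] := fdf _ e0.
exists d => // h hd; have [->|h0] := eqVneq h 0.
  by rewrite subrr mul0r subrr normr0 mulr0.
by have := Hd h; rewrite /ball /= sub0r normrN addr0; apply.
Qed.

(** This is the first-order expansion of the complex exponential at [0], written in real and
    imaginary parts. *)
Lemma expR_cis_bound (e : R) : 0 < e -> exists2 d : R, 0 < d &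
  forall x y, `|x| < d -> `|y| < d ->
    `|expR x * cos y - 1 - x| + `|expR x * sin y - y| <= e * (`|x| + `|y|).
Proof.
(* The errors below add up to at most [5 * e1 * (|x| + |y|)], whence [e / 5]. The bound [e1 <= 1]
   gives [|expR x - 1| <= 2 * |x|], and with the radius [e1 / 2] this yields [|expR x - 1| <= e1]
   and [expR x <= 2]. *)
move=> e0; pose e1 := Num.min 1 (e / 5).
have e10 : 0 < e1 by rewrite lt_min ltr01 divr_gt0.
have e11 : e1 <= 1 by rewrite ge_min lexx.
have e1e : e1 <= e / 5 by rewrite ge_min lexx orbT.
have [d1 d10 Hexp] := is_derive_bound (is_derive_expR 0) e10.
have [d2 d20 Hcos] := is_derive_bound (is_derive_cos 0) e10.
have [d3 d30 Hsin] := is_derive_bound (is_derive_sin 0) e10.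
exists (Num.min (Num.min d1 d2) (Num.min d3 (e1 / 2))).
  by rewrite !lt_min d10 d20 d30 divr_gt0.
move=> x y; rewrite !lt_min => /andP[/andP[xd1 _] /andP[_ xe]].
move=> /andP[/andP[_ yd2] /andP[yd3 ye]].
have := Hexp x xd1; have := Hcos y yd2; have := Hsin y yd3.
rewrite expR0 cos0 sin0 oppr0 !mulr0 !mulr1 !subr0 addr0 => Hs Hc He.
have E1 : `|expR x - 1| <= 2 * `|x|.
  rewrite -[_ - 1](subrK x); apply: (le_trans (ler_normD _ _)).
  by have := normr_ge0 x; nra.
have E2 : expR x <= 2.
  have : `|expR x - 1| <= 1 by lra.
  by rewrite ler_norml; lra.
have Ep := expR_gt0 x.
have HA : `|expR x * cos y - 1 - x| <= 2 * e1 * `|y| + e1 * `|x|.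
  rewrite (_ : _ - x = expR x * (cos y - 1) + (expR x - 1 - x)); last by ring.
  apply: (le_trans (ler_normD _ _)); rewrite lerD // normrM gtr0_norm //.
  rewrite -mulrA; apply: ler_pM => //; exact: ltW.
have HB : `|expR x * sin y - y| <= 2 * e1 * `|y| + e1 * `|y|.
  rewrite (_ : _ - y = expR x * (sin y - y) + (expR x - 1) * y); last by ring.
  apply: (le_trans (ler_normD _ _)); rewrite !normrM [ `|expR x| ]gtr0_norm //.
  apply: lerD; last by apply: ler_wpM2r => //; lra.
  rewrite -mulrA; apply: ler_pM => //; exact: ltW.
have y0 := normr_ge0 y; have x0 := normr_ge0 x; nra.
Qed.

Lemma normc_le (x y : R) : `|(x +i* y : C)| <= (`|x| + `|y|)%:C.
Proof.
have -> : (x +i* y : C) = x%:C + 'i%C * y%:C by exact: (complexE (x +i* y)).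
have nr (u : R) : `|u%:C : C| = `|u|%:C.
  by rewrite normc_def /= expr0n addr0 sqrtr_sqr.
apply: (le_trans (ler_normD _ _)); rewrite rmorphD /= normrM !nr.
by rewrite normc_def /= expr0n add0r expr1n sqrtr1 mul1r.
Qed.

Lemma ReIm_le_norm (h : C) : (`|complex.Re h| + `|complex.Im h|)%:C <= 2 * `|h|.
Proof.
rewrite rmorphD /= mulr_natl mulr2n; apply: lerD; first exact: normc_ge_Re.
(* Multiplication by [i] moves the imaginary part, up to sign, into the real part without changing
   the modulus. *)
have := normc_ge_Re (h * 'i%C); rewrite ReiNIm normrN => /le_trans; apply.
by rewrite normrM [ `|'i%C| ]normc_def /= expr0n add0r expr1n sqrtr1 mulr1.
Qed.

Lemma qpow_near0 (e : R) : 0 < e ->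
  \forall h \near (0 : C)^', `|qpow F h - 1 - h * (ln #|F|%:R)%:C| <= e%:C * `|h|.
Proof.
set l : R := ln _ => e0; have l0 : 0 < l := lnq_gt0.
(* The factor [l] undoes the rescaling of the coordinates by [ln q], and the factor [2] pays for
   comparing [|x| + |y|] with the modulus. *)
have e20 : 0 < e / (2 * l) by rewrite divr_gt0 // mulr_gt0.
have [d d0 Hd] := expR_cis_bound e20.
have dC : 0 < (d / (2 * l))%:C :> C by rewrite ltcR divr_gt0 // mulr_gt0.
have := @dnbhs0_lt C C _ dC; apply: filterS => h hd.
have := ReIm_le_norm h; case: h hd => [x y] hd /= xyh.
have : (`|x| + `|y|)%:C < (d / l)%:C :> C.
  apply: (le_lt_trans xyh); rewrite mulrC -ltr_pdivlMr //.
  by rewrite -(rmorph_nat (real_complex R)) -fmorphV -rmorphM /= -mulrA -invfM [l * _]mulrC.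
rewrite ltcR ltr_pdivlMr // => xyd.
have xl : `|x * l| < d.
  rewrite normrM (gtr0_norm l0); apply: le_lt_trans xyd.
  by rewrite ler_pM2r // lerDl.
have yl : `|y * l| < d.
  rewrite normrM (gtr0_norm l0); apply: le_lt_trans xyd.
  by rewrite ler_pM2r // lerDr.
have -> : qpow F (x +i* y : C) - 1 - (x +i* y) * l%:C =
    (expR (x * l) * cos (y * l) - 1 - x * l) +i* (expR (x * l) * sin (y * l) - y * l).
  rewrite qpowE /= -/l !mulcE !(mul0r, mulr0, subr0, addr0, add0r).
  rewrite -[1]/(1 +i* 0) -[LHS]/(_ +i* _).
  by rewrite subr0.
apply: (le_trans (normc_le _ _)).
apply: (@le_trans _ _ (e / 2 * (`|x| + `|y|))%:C).
  rewrite lecR; apply: (le_trans (Hd _ _ xl yl)).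
  rewrite !normrM (gtr0_norm l0) le_eqVlt; apply/orP; left; apply/eqP.
  by field; rewrite gt_eqF.
rewrite !rmorphM /= -mulrA ler_pM2l ?ltcR // fmorphV rmorph_nat.
by rewrite ler_pdivrMl // ltr0n.
Qed.

(** The law [q^(h+s) = q^h q^s] reduces the derivative at [s] to the expansion at [0]. *)
Lemma is_derive_qpow (s : C) :
  is_derive s 1 (@qpow R F) ((ln #|F|%:R)%:C * qpow F s).
Proof.
apply/is_derive_normP => e e0.
have qs0 : 0 < `|qpow F s| by rewrite normr_gt0 qpow_neq0.
(* A positive element of [R[i]] is real, so the complex tolerance can be handed to a real
   estimate. *)
have ee : e = (complex.Re e)%:C by rewrite RRe_real // gtr0_real.
have qe : `|qpow F s| = (complex.Re `|qpow F s|)%:C by rewrite RRe_real // normr_real.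
have := @qpow_near0 (complex.Re e / complex.Re `|qpow F s|).
have -> : 0 < complex.Re e / complex.Re `|qpow F s|.
  by rewrite divr_gt0 // -ltcR -?ee -?qe.
move=> /(_ isT); apply: filterS => h hq.
have -> : qpow F (h + s) - qpow F s - h * ((ln #|F|%:R)%:C * qpow F s) =
  (qpow F h - 1 - h * (ln #|F|%:R)%:C) * qpow F s by rewrite qpowD; ring.
rewrite normrM -ler_pdivlMr //; apply: (le_trans hq).
by rewrite rmorphM fmorphV /= -ee {1}qe /= mulrAC.
Qed.

Lemma holomorphic_qpow (s : C) : holomorphic_at (@qpow R F) s.
Proof. by apply: filterE => w; have [] := is_derive_qpow w. Qed.

Lemma dnbhs_shift (K : numFieldType) (a : K) (P : set K) :
  (\forall h \near 0^', P (h + a)) -> \forall w \near a^', P w.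
Proof.
rewrite /dnbhs /within /= => aP.
change (\forall w \near a, w != a -> P w); rewrite (near_shift (0 : K)).
apply: (@filterS _ (nbhs (0 : K)) _ _ _ _ aP) => h /= hP.
by rewrite subr0 -subr_eq0 addrK.
Qed.

(** If [f (a + h) = f a], the linear term [h * df] would have to be absorbed by an error of half its
    size. *)
Lemma is_derive_neq_near (K : numFieldType) (f : K -> K) (a df : K) :
  is_derive a 1 f df -> df != 0 -> \forall w \near a^', f w != f a.
Proof.
move=> /is_derive_normP fdf df0.
have e0 : 0 < `|df| / 2 by rewrite divr_gt0 // normr_gt0.
have neq : \forall h \near (0 : K)^', h != 0 by exact: nbhs_dnbhs_neq.
apply: dnbhs_shift; apply: filterS2 neq (fdf _ e0) => h h0; apply: contraTneq => ->.
rewrite subrr sub0r normrN normrM mulrC ler_pM2r ?normr_gt0 //.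
by rewrite lt_geF // ltr_pdivrMr // ltr_pMr ?normr_gt0 // ltr1n.
Qed.

(** The derivative of [q^s] never vanishes, so its level sets are discrete. The zeros of [c_in] and
    [c_out] and the singular set of [F] are all reduced to such level sets. *)
Lemma qpow_neq_near (c : C) z : \forall w \near z^', qpow F w != c.
Proof.
have [<-|zc] := eqVneq (qpow F z) c.
  apply: (is_derive_neq_near (is_derive_qpow z)).
  by rewrite mulf_neq0 ?qpow_neq0 // (fmorph_eq0 (real_complex R)) gt_eqF // lnq_gt0.
apply: near_dnbhs; apply: (continuous_neq _ zc).
exact: holomorphic_continuous (holomorphic_qpow z).
Qed.

End ComplexExponential.

(** * The parameter [zeta] and the factors [c_in] and [c_out] *)

Section ZetaParameter.
Variables (R : realType) (F : finFieldType).
Local Notation C := (Cx R).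
Implicit Types s z : C.

Lemma zetaE s : zeta F s = qpow F s / sqrtq R F.
Proof. by rewrite /zeta qpowD qpowN qpow_half. Qed.

Lemma zeta_neq0 s : zeta F s != 0.
Proof. exact: qpow_neq0. Qed.

Lemma zeta_onem s : zeta F (1 - s) = (zeta F s)^-1.
Proof.
rewrite /zeta -qpowN; congr (qpow F _).
rewrite opprB addrAC; congr (_ - s); apply: (@addIr _ 2^-1); rewrite subrK.
by rewrite -mulr2n -[_ *+ _]mulr_natl divff // pnatr_eq0.
Qed.

Lemma c_in_zeta s : c_in F (zeta F s) = qpow F (s - 1) - qpow F (1 - s).
Proof.
rewrite /c_in zetaE !qpowD !qpowN qpow1 -sqr_sqrtq.
by field; rewrite qpow_neq0 sqrtq_neq0.
Qed.

Lemma c_out_zeta s : c_out F (zeta F s) = qpow F s - qpow F (- s).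
Proof.
by rewrite /c_out zetaE qpowN; field; rewrite qpow_neq0 sqrtq_neq0.
Qed.

Lemma xpar_zeta s : qpow F s + qpow F (1 - s) = xpar F (zeta F s).
Proof.
rewrite /xpar zetaE !qpowD !qpowN qpow1 -sqr_sqrtq.
by field; rewrite qpow_neq0 sqrtq_neq0.
Qed.

(** The reflection [s -> 1 - s] inverts [zeta] and, up to sign, exchanges [c_in] and [c_out]; this
    is why the scalar factors cancel in the functional equation of [Phi]. *)
Lemma c_inV (z : C) : z != 0 -> c_in F z^-1 = - c_out F z.
Proof. by move=> z0; rewrite /c_in /c_out invrK opprB [sqrtq R F * _]mulrC. Qed.

Lemma c_outV (z : C) : z != 0 -> c_out F z^-1 = - c_in F z.
Proof. by move=> z0; rewrite /c_in /c_out invrK opprB [sqrtq R F * _]mulrC. Qed.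

Lemma holomorphic_zeta z : holomorphic_at (@zeta R F) z.
Proof.
rewrite (_ : zeta F = fun s : C => qpow F s / sqrtq R F); last exact/funext/zetaE.
exact: holomorphicM (holomorphic_qpow F z) (holomorphic_cst _ z).
Qed.

Lemma holomorphic_zetaV z : holomorphic_at (fun s => (zeta F s)^-1) z.
Proof. exact: holomorphicV (holomorphic_zeta z) (zeta_neq0 z). Qed.

Lemma holomorphic_c_in z : holomorphic_at (fun s => c_in F (zeta F s)) z.
Proof.
apply: holomorphicD; first exact: holomorphicM (holomorphic_zeta z) (holomorphic_cst _ z).
apply: holomorphicN; exact: holomorphicM (holomorphic_cst _ z) (holomorphic_zetaV z).
Qed.

Lemma holomorphic_c_out z : holomorphic_at (fun s => c_out F (zeta F s)) z.
Proof.
apply: holomorphicD; first exact: holomorphicM (holomorphic_cst _ z) (holomorphic_zeta z).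
apply: holomorphicN; exact: holomorphicM (holomorphic_zetaV z) (holomorphic_cst _ z).
Qed.

(** The factored form exhibits the zeros [q^s = q] and [q^s = -q] separately, each a zero of a
    function [q^s - c] with nowhere vanishing derivative. *)
Lemma c_in_zetaE s : c_in F (zeta F s) =
  (qpow F s - #|F|%:R) * (qpow F s + #|F|%:R) / (#|F|%:R * qpow F s).
Proof.
rewrite c_in_zeta !qpowD !qpowN qpow1; field.
by rewrite qpow_neq0 pnatr_eq0 -lt0n (ltn_trans _ (cardF_gt1 _)).
Qed.

Lemma discrete_qpow_level (c : C) : discrete [set s | qpow F s = c].
Proof.
by move=> z; apply: filterS (qpow_neq_near F c z) => w wc /= /eqP; rewrite (negbTE wc).
Qed.

Lemma discrete_c_in : discrete [set s : C | c_in F (zeta F s) = 0].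
Proof.
apply: (sub_discrete _ (discrete_setU (discrete_qpow_level (#|F|%:R))
  (discrete_qpow_level (- #|F|%:R)))) => s /= /eqP.
rewrite c_in_zetaE !mulf_eq0 subr_eq0 addr_eq0 invr_eq0 mulf_eq0.
rewrite (negbTE (qpow_neq0 F s)) pnatr_eq0 orbF -orbA 
  => /or3P[/eqP|/eqP|/eqP q0]; [by left|by right|].
by have := cardF_gt1 F; rewrite q0.
Qed.

Lemma discrete_c_out : discrete [set s : C | c_out F (zeta F s) = 0].
Proof.
apply: (sub_discrete _ (discrete_setU (discrete_qpow_level 1)
  (discrete_qpow_level (-1)))) => s /=.
rewrite c_out_zeta qpowN => /subr0_eq e.
have /eqP : qpow F s ^+ 2 = 1 by rewrite expr2 {2}e divff // qpow_neq0.
by rewrite sqrf_eq1 => /orP[] /eqP ->; [left|right].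
Qed.

(** A nowhere vanishing derivative makes every zero of [f] simple, so its reciprocal has at worst
    simple poles. *)
Lemma meromorphic_simple_zeroV (f : C -> C) :
  (forall z, holomorphic_at f z) -> (forall z, 'D_1 f z != 0) ->
  meromorphic (fun s => (f s)^-1).
Proof.
move=> hf df z; have [fz0|fz0] := eqVneq (f z) 0; last first.
  exists 0%N, (fun s => (f s)^-1); split; first exact: holomorphicV (hf z) fz0.
  by apply: filterE => w; rewrite expr0 mul1r.
(* The exponent 2 rather than 1 makes differentiability at [z] a first-order
   statement about [f]. *)
have hsq (w : C) : holomorphic_at (fun s => (s - z) ^+ 2) w.
  exact: (holomorphicX 2 (holomorphicD (holomorphic_id w) (holomorphic_cst (- z) w))).
exists 2%N, (fun s => (s - z) ^+ 2 * (f s)^-1); split; last exact: filterE.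
have fz := holomorphic_derivable (hf z).
have := is_derive_neq_near (derivableP fz) (df z).
rewrite fz0 => f0; apply: dnbhs_nbhs; last first.
  apply: filterS f0 => w fw.
  exact: holomorphic_derivable (holomorphicM (hsq w) (holomorphicV (hf w) fw)).
(* At a zero [z] of [f] the difference quotient of [(s - z)^2 / f s] is [h / f (z + h)], the
   reciprocal of that of [f]; the value at [z] itself is [0]. *)
apply/cvg_ex; exists ('D_1 f z)^-1.
have cf : h^-1 *: (f (h *: 1 + z) - f z) @[h --> (0 : C)^'] --> 'D_1 f z by [].
have cfV : (h^-1 *: (f (h *: 1 + z) - f z))^-1 @[h --> (0 : C)^'] --> ('D_1 f z)^-1.
  exact: cvgV (df z) cf.
apply: cvg_trans cfV; apply: near_eq_cvg.
have neq : \forall h \near (0 : C)^', h != 0 by exact: nbhs_dnbhs_neq.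
apply: filterS neq => h h0; rewrite /= fz0 invr0 mulr0 !subr0 addrK.
rewrite [h *: 1]mulr1 [_ *: f _]/(_ * _) [RHS]/(_ * _) invfM invrK expr2.
by rewrite -[RHS]/(h^-1 * (h * h * (f (h + z))^-1)) -mulrA mulKf.
Qed.

Lemma meromorphic_c_inV : meromorphic (fun s : C => (c_in F (zeta F s))^-1).
Proof.
have mero (c : C) : meromorphic (fun s => (qpow F s - c)^-1).
  apply: meromorphic_simple_zeroV => z.
    exact: holomorphicD (holomorphic_qpow F z) (holomorphic_cst _ z).
  have := is_deriveD (is_derive_qpow F z) (is_derive_cst (- c) z 1).
  rewrite addr0 => -[_ ->].
  by rewrite mulf_neq0 ?qpow_neq0 // (fmorph_eq0 (real_complex R)) gt_eqF // lnq_gt0.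
have -> : (fun s : C => (c_in F (zeta F s))^-1) = fun s : C =>
    (qpow F s - #|F|%:R)^-1 * (qpow F s - - #|F|%:R)^-1 * (#|F|%:R * qpow F s).
  by apply/funext => s; rewrite c_in_zetaE opprK invfM invrK invfM.
apply: meromorphicM; first exact: (meromorphicM (mero _) (mero _)).
apply: holomorphic_meromorphic => z.
exact: holomorphicM (holomorphic_cst _ z) (holomorphic_qpow F z).
Qed.

End ZetaParameter.

(** * Matrices of holomorphic functions *)

Section HolomorphicMatrices.
Variable R : realType.
Local Notation C := (Cx R).

Lemma mx_holomorphic_cst m n (M : 'M[C]_(m, n)) z : mx_holomorphic_at (fun=> M) z.
Proof. by move=> i j; exact: holomorphic_cst. Qed.

Lemma mx_holomorphicD m n (M N : C -> 'M[C]_(m, n)) z :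
  mx_holomorphic_at M z -> mx_holomorphic_at N z ->
  mx_holomorphic_at (fun s => M s + N s) z.
Proof.
move=> hM hN i j; under eq_fun do rewrite mxE; exact: holomorphicD (hM i j) (hN i j).
Qed.

Lemma mx_holomorphicZ m n (c : C -> C) (M : C -> 'M[C]_(m, n)) z :
  holomorphic_at c z -> mx_holomorphic_at M z ->
  mx_holomorphic_at (fun s => c s *: M s) z.
Proof.
move=> hc hM i j; under eq_fun do rewrite mxE; exact: holomorphicM hc (hM i j).
Qed.

Lemma mx_holomorphicM m n p (M : C -> 'M[C]_(m, n)) (N : C -> 'M[C]_(n, p)) z :
  mx_holomorphic_at M z -> mx_holomorphic_at N z ->
  mx_holomorphic_at (fun s => M s *m N s) z.
Proof.
move=> hM hN i j; under eq_fun do rewrite mxE.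
apply: holomorphic_sum => k _; exact: holomorphicM (hM i k) (hN k j).
Qed.

Lemma holomorphic_det n (M : C -> 'M[C]_n) z :
  mx_holomorphic_at M z -> holomorphic_at (fun s => \det (M s)) z.
Proof.
move=> hM; apply: holomorphic_sum => s _.
apply: holomorphicM; first exact: holomorphic_cst.
by apply: holomorphic_prod => i _; exact: hM.
Qed.

Lemma unitmx_near n (M : C -> 'M[C]_n) z :
  mx_holomorphic_at M z -> M z \in unitmx -> \forall w \near z, M w \in unitmx.
Proof.
move=> hM; rewrite unitmxE unitfE => dM.
have := continuous_neq (holomorphic_continuous (holomorphic_det hM)) dM.
by apply: filterS => w; rewrite unitmxE unitfE.
Qed.

(** Near [z] the determinant stays nonzero by continuity, and there Cramer's rule expresses the
    inverse by determinants of holomorphic entries. *)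
Lemma mx_holomorphicV n (M : C -> 'M[C]_n) z :
  mx_holomorphic_at M z -> M z \in unitmx ->
  mx_holomorphic_at (fun s => invmx (M s)) z.
Proof.
move=> hM uM i j.
apply: (@near_eq_holomorphic _ (fun s => (\det (M s))^-1 * \adj (M s) i j)).
  have := unitmx_near hM uM; apply: filterS => w uw.
  by rewrite /invmx uw [in RHS]mxE.
apply: holomorphicM.
  by apply: holomorphicV; [exact: holomorphic_det|rewrite -unitfE -unitmxE].
under eq_fun do rewrite mxE.
apply: holomorphicM; first exact: holomorphic_cst.
apply: holomorphic_det => k l; under eq_fun do rewrite !mxE; exact: hM.
Qed.

(** This is the form in which identities cross singular parameters: holomorphy at [z] is asked of
    [N] only, since the value of [M] at [z] is fixed by [continued]. *)
Lemma mx_continuation_near_eq m n (M N : C -> 'M[C]_(m, n)) z :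
  mx_is_continuation M -> mx_holomorphic_at N z ->
  (\forall w \near z^', M w = N w) -> M z = N z.
Proof.
move=> cM hN MN; apply/matrixP => i j; have [_ cMij] := cM i j.
rewrite -[M z i j]/((fun s => M s i j) z) -cMij.
by apply: (continuedE (hN i j)); apply: filterS MN => w ->.
Qed.

(** A nonzero polynomial splits with finitely many roots, so the set is a finite union of level sets
    of [g]. *)
Lemma discrete_root (p : {poly C}) (g : C -> C) : p != 0 ->
  (forall c, discrete [set s | g s = c]) -> discrete [set s | root p (g s)].
Proof.
move=> p0 dg; have [rs prs] := closed_field_poly_normal p.
apply: (@sub_discrete _ _ [set s | g s \in rs]).
  move=> s /=; rewrite prs rootZ ?lead_coef_eq0 //.
  by rewrite root_prod_XsubC.
elim: rs {prs} => [|c rs IHrs]; first by move=> z; apply: filterE => w.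
apply: (sub_discrete _ (discrete_setU (dg c) IHrs)) => s /=.
by rewrite inE => /orP[/eqP|]; [left|right].
Qed.

End HolomorphicMatrices.

(** * The Bruhat-Tits tree is locally finite *)

Section FiniteSums.
Implicit Types (T U : choiceType).

Lemma sum_fset_fiber (V : nmodType) T U (A : set T) (f : T -> U) (F : T -> V) :
  finite_set A ->
  \sum_(x <- fset_set A) F x =
  \sum_(b <- fset_set (f @` A)) \sum_(x <- fset_set (A `&` f @^-1` [set b])) F x.
Proof.
move=> finA; have finI := finite_image f finA.
rewrite (eq_big_seq (fun x => \sum_(b <- fset_set (f @` A) | f x == b) F x)); last first.
  move=> x; rewrite in_fset_set // => /set_mem Ax.
  have fxB : f x \in fset_set (f @` A) by rewrite in_fset_set //; apply/mem_set; exists x.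
  rewrite big_mkcond (bigD1_seq (f x)) //= eqxx big1 ?addr0 // => b /negbTE.
  by rewrite eq_sym => ->.
rewrite (exchange_big_dep xpredT) //=; apply: eq_bigr => b _.
rewrite -big_filter; apply: perm_big.
apply: uniq_perm; rewrite ?filter_uniq // => x.
rewrite mem_filter !in_fset_set //; last exact: finite_setIl.
apply/andP/idP => [[/eqP fx /set_mem Ax]|/set_mem[Ax fx]]; first exact/mem_set.
by split; [exact/eqP|exact/mem_set].
Qed.

Lemma ncard_fiber T U (A : set T) (B : set U) (f : T -> U) k :
  finite_set A -> f @` A = B ->
  (forall b, B b -> ncard (A `&` f @^-1` [set b]) = k) ->
  ncard A = (ncard B * k)%N.
Proof.
move=> finA fAB fk; rewrite /ncard -sum1_size.
have := @sum_fset_fiber nat T U A f (fun=> 1%N) finA.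
rewrite -/(\sum_(x <- _) 1)%N /= => ->.
have finB : finite_set B by rewrite -fAB; exact: finite_image.
rewrite fAB (eq_big_seq (fun=> k)) => [|b]; last first.
  by rewrite in_fset_set // => /set_mem /fk <-; rewrite /ncard -sum1_size.
by rewrite big_const_seq count_predT iter_addn_0 mulnC.
Qed.

Lemma ncard_bij T U (A : set T) (f : T -> U) :
  finite_set A -> {in A &, injective f} -> ncard (f @` A) = ncard A.
Proof.
move=> finA injf; rewrite (@ncard_fiber _ _ A (f @` A) f 1) ?muln1 // => _ [a Aa <-].
suff -> : A `&` f @^-1` [set f a] = [set a] by rewrite /ncard fset_set1 cardfs1.
apply/seteqP; split => [x [Ax fx]|_ ->] //.
by apply: injf => //; exact/mem_set.
Qed.

End FiniteSums.

Lemma unitmx_scale (E : fieldType) n (c : E) (A : 'M[E]_n) :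
  c != 0 -> A \in unitmx -> c *: A \in unitmx.
Proof. by move=> c0 uA; rewrite unitmxZ ?unitfE. Qed.

Lemma invmx_unit (E : fieldType) n (A : 'M[E]_n) : A \in unitmx -> invmx A \in unitmx.
Proof. by rewrite unitmx_inv. Qed.

(** * Lattices, homothety classes and neighbours in the tree *)

Section BruhatTitsTree.
Variable F : finFieldType.
Local Notation K := (laurent F).
Implicit Types (g h : 'M[K]_2) (L : set 'cV[K]_2) (x y : vclass F).

Definition matimg g L : set 'cV[K]_2 := [set g *m v | v in L].

Definition lclass L : vclass F := [set homothety c L | c in [set c | c != 0]].

Lemma matimg1 L : matimg 1%:M L = L.
Proof. by rewrite /matimg; under eq_fun do rewrite mul1mx; exact: image_id. Qed.

Lemma matimgM g h L : matimg (g *m h) L = matimg g (matimg h L).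
Proof. by rewrite /matimg image_comp; congr image; apply/funext => v /=; rewrite mulmxA. Qed.

Lemma matimg_scalar c L : matimg c%:M L = homothety c L.
Proof. by congr image; apply/funext => v; rewrite mul_scalar_mx. Qed.

Lemma matimg_scale c g L : matimg (c *: g) L = homothety c (matimg g L).
Proof. by rewrite -mul_scalar_mx matimgM matimg_scalar. Qed.

Lemma matimg_homothety c g L : matimg g (homothety c L) = homothety c (matimg g L).
Proof. by rewrite -!matimg_scalar -!matimgM scalar_mxC. Qed.

Lemma homothetyM c c' L : homothety c (homothety c' L) = homothety (c * c') L.
Proof. by rewrite -!matimg_scalar -matimgM -scalar_mxM. Qed.

Lemma homothety1 L : homothety 1 L = L.
Proof. by rewrite -matimg_scalar matimg1. Qed.

Lemma actE g x : act g x = [set matimg g L | L in x].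
Proof. by []. Qed.

Lemma act1 x : act 1%:M x = x.
Proof. by rewrite actE; under eq_fun do rewrite matimg1; exact: image_id. Qed.

Lemma actM g h x : act (g *m h) x = act g (act h x).
Proof. by rewrite !actE image_comp; congr image; apply/funext => L /=; rewrite matimgM. Qed.

Lemma actK g x : g \in unitmx -> act (invmx g) (act g x) = x.
Proof. by move=> ug; rewrite -actM mulVmx // act1. Qed.

Lemma act_lclass g L : act g (lclass L) = lclass (matimg g L).
Proof.
rewrite actE /lclass image_comp; congr image; apply/funext => c /=.
exact: matimg_homothety.
Qed.

Lemma tree_vertexP x : tree_vertex x <-> exists2 L, is_lattice L & x = lclass L.
Proof. by split=> -[L lL xL]; exists L. Qed.

Lemma is_lattice_matimg g L : g \in unitmx -> is_lattice L -> is_lattice (matimg g L).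
Proof.
move=> ug [h uh ->]; exists (g *m h); first by rewrite unitmx_mul ug.
by rewrite -/(matimg h _) -matimgM.
Qed.

Lemma act_vertex g x : g \in unitmx -> tree_vertex x -> tree_vertex (act g x).
Proof.
move=> ug /tree_vertexP[L lL ->]; apply/tree_vertexP.
by exists (matimg g L); [exact: is_lattice_matimg|exact: act_lclass].
Qed.

Lemma homothety_lclass c L : c != 0 -> lclass (homothety c L) = lclass L.
Proof.
move=> c0; apply/seteqP; split => _ [c' /= c'0 <-].
  rewrite homothetyM; exists (c' * c); [exact: (mulf_neq0 c'0 c0)|reflexivity].
exists (c' * c^-1); last by rewrite homothetyM (divfK c0).
apply: (mulf_neq0 c'0); rewrite invr_eq0; exact: c0.
Qed.

Lemma lclass_sym L L' : lclass L L' -> lclass L' L.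
Proof.
move=> [c /= c0 <-]; exists c^-1; first exact: invr_neq0 c0.
by rewrite homothetyM (mulVf c0) homothety1.
Qed.

Lemma vertex_lclass x L : tree_vertex x -> x L -> x = lclass L.
Proof. by move=> /tree_vertexP[L' _ ->] [c /= c0 <-]; rewrite homothety_lclass. Qed.

Lemma vertex_homothety x L c : tree_vertex x -> x L -> c != 0 -> x (homothety c L).
Proof. by move=> vx xL c0; rewrite (vertex_lclass vx xL); exists c. Qed.

Lemma act_scalar c x : tree_vertex x -> c != 0 -> act c%:M x = x.
Proof.
by move=> /tree_vertexP[L _ ->] c0; rewrite act_lclass matimg_scalar homothety_lclass.
Qed.

Lemma act_scale c g x : tree_vertex x -> c != 0 -> g \in unitmx ->
  act (c *: g) x = act g x.
Proof.
move=> vx c0 ug; rewrite -mul_scalar_mx actM act_scalar; last exact: c0; first by [].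
exact: act_vertex.
Qed.

Lemma matimg_proper g L L' : g \in unitmx -> L `<` L' -> matimg g L `<` matimg g L'.
Proof.
move=> ug [sLL' nLL']; split; first exact: image_subset.
move=> sL'; apply: nLL' => v L'v; have [|v' Lv' e] := sL' (g *m v); first by exists v.
by rewrite -(mulKmx ug v) -e mulKmx.
Qed.

Lemma homothety_proper c L L' : c != 0 -> L `<` L' -> homothety c L `<` homothety c L'.
Proof.
move=> c0; rewrite -!matimg_scalar; apply: matimg_proper.
by rewrite unitmxE det_scalar unitfE expf_neq0.
Qed.

Lemma act_adj g x y : g \in unitmx -> tree_adj x y -> tree_adj (act g x) (act g y).
Proof.
move=> ug [L [L' [xL yL' s1 s2]]]; exists (matimg g L), (matimg g L'); split.
- by exists L.
- by exists L'.
- by rewrite -matimg_homothety; exact: matimg_proper.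
- exact: matimg_proper.
Qed.

Lemma uniformizer_neq0 : uniformizer F != 0.
Proof.
rewrite /uniformizer tofrac_eq0; apply/eqP => /(congr1 (fun f => pcoef f 1)) /= /eqP.
by rewrite oner_eq0.
Qed.

(** The chain of lattices is periodic under the uniformizer [pi]: from [pi L < L' < L] one gets
    [pi L' < pi L < L'], where [pi L] still represents [x]. *)
Lemma adj_sym x y : tree_vertex x -> tree_adj x y -> tree_adj y x.
Proof.
move=> vx [L [L' [xL yL' s1 s2]]]; exists L', (homothety (uniformizer F) L); split => //.
  exact: vertex_homothety uniformizer_neq0.
exact: homothety_proper uniformizer_neq0 _.
Qed.

Definition residue (f : 'cV[Defs.pseries F]_2) : 'cV[F]_2 := \col_i pcoef (f i 0) 0.

Definition embed (f : 'cV[Defs.pseries F]_2) : 'cV[K]_2 := map_mx (@tofrac (Defs.pseries F)) f.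

Lemma pseries_residue0 (f : Defs.pseries F) : pcoef f 0 = 0 ->
  exists f', f = PSeries (fun n => (n == 1%N)%:R) * f'.
Proof.
move=> f0; exists (PSeries (fun n => pcoef f n.+1)); apply: pseriesP => -[|n] /=.
  by rewrite big_ord_recl big_ord0 /= mul0r addr0.
rewrite 2!big_ord_recl /= mul0r mul1r add0r subSS subn0 big1 ?addr0 // => i _.
by rewrite mul0r.
Qed.

Lemma std_latticeP v : std_lattice v <-> exists f, v = embed f.
Proof.
split=> [sv|[f ->] i]; last by rewrite mxE; exists (f i 0).
have fi i : {f | tofrac f = v i 0}.
  by apply: cid; have [f _ fv] := sv i; exists f.
exists (\col_i sval (fi i)); apply/colP => i; rewrite !mxE.
by case: (fi i) => f /= ->.
Qed.

Lemma std_lattice_residue0 f : residue f = 0 ->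
  homothety (uniformizer F) (@std_lattice F) (embed f).
Proof.
move=> rf.
have hi i : {f' | f i 0 = PSeries (fun n => (n == 1%N)%:R) * f'}.
  by apply/cid/pseries_residue0; have /colP/(_ i) := rf; rewrite !mxE.
exists (embed (\col_i sval (hi i))); first by apply/std_latticeP; exists (\col_i sval (hi i)).
apply/colP => i; rewrite !mxE /uniformizer -rmorphM /=.
by case: (hi i) => h /= <-.
Qed.

Lemma lattice_add L u v : is_lattice L -> L u -> L v -> L (u + v).
Proof.
move=> [g _ ->] [u' su <-] [v' sv <-]; exists (u' + v'); last by rewrite mulmxDr.
move/std_latticeP: su => [f ->]; move/std_latticeP: sv => [f' ->].
by apply/std_latticeP; exists (f + f'); rewrite /embed map_mxD.
Qed.

(* A lattice between [pi O^2] and [O^2] is determined by its image in the finite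
   space [O^2 / pi O^2 = F^2]. *)
Definition lattice_of_residues (S : {set 'cV[F]_2}) : set 'cV[K]_2 :=
  [set embed f | f in [set f | residue f \in S]].

Lemma lattice_of_residuesE L : is_lattice L ->
  homothety (uniformizer F) (@std_lattice F) `<=` L -> L `<=` @std_lattice F ->
  exists S, L = lattice_of_residues S.
Proof.
move=> lL sL Ls; pose S := [set r | `[< exists2 f, L (embed f) & residue f = r >]]%SET.
exists S; apply/seteqP; split => [v Lv|_ [f + <-]].
  have /std_latticeP[f vf] := Ls v Lv; exists f => //=; rewrite inE.
  by apply/asboolP; exists f; rewrite -?vf.
rewrite /= inE => /asboolP[f' Lf' rf].
(* The difference [f - f'] has zero residue, hence lies in the uniformizer times the standard
   lattice, which [L] contains. *)
rewrite -(subrK f' f) /embed map_mxD; apply: lattice_add => //.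
apply: sL; apply: std_lattice_residue0; apply/colP => i.
by have /colP/(_ i) := rf; rewrite !mxE /= => ->; rewrite subrr.
Qed.

(** After moving a lattice of [x] to the standard one, each neighbour has a representative squeezed
    between it and its multiple by the uniformizer, so it is determined by a subset of the finite
    space [F^2]. *)
Lemma finite_neighbors x : tree_vertex x ->
  finite_set [set y | tree_vertex y /\ tree_adj x y].
Proof.
move=> vx; have /tree_vertexP[L0 [g ug L0E] xL0] := vx.
have finS : finite_set (range (fun S => lclass (matimg g (lattice_of_residues S)))).
  by apply: finite_image; exact: finite_finset.
apply: sub_finite_set finS => y [vy [L [L' [xL yL' s1 s2]]]].
(* The adjacency provides its own lattice [L] of [x]; the scalar [c] carrying it to the fixed [L0]
   rescales [L'] at the same time. *)
have [c /= c0 LE] : lclass L L0 by apply: lclass_sym; rewrite -xL0.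
have uc : c *: invmx g \in unitmx := unitmx_scale c0 (invmx_unit ug).
pose L'' := matimg (c *: invmx g) L'.
have L'E : matimg g L'' = homothety c L'.
  by rewrite /L'' matimg_scale matimg_homothety -matimgM (mulmxV ug) matimg1.
have stdE : matimg (c *: invmx g) L = @std_lattice F.
  by rewrite matimg_scale -matimg_homothety LE L0E -/(matimg g _) -matimgM (mulVmx ug) matimg1.
have [S SE] : exists S, L'' = lattice_of_residues S.
  apply: lattice_of_residuesE; last 2 first.
  - by rewrite -stdE -matimg_homothety; apply: image_subset; case: s1.
  - by rewrite -stdE; apply: image_subset; case: s2.
  apply: is_lattice_matimg => //.
  have /tree_vertexP[L1 [h uh L1E] yL1] := vy.
  have [c1 /= c10 <-] : lclass L1 L' by rewrite -yL1.
  rewrite -matimg_scalar; apply: is_lattice_matimg; last by exists h.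
  by rewrite unitmxE det_scalar unitfE expf_neq0.
exists S => //; rewrite -SE L'E (homothety_lclass _ c0).
by rewrite (vertex_lclass vy yL').
Qed.

End BruhatTitsTree.

(** * Counting neighbours in the quotient *)

Section LatticeAction.
Variables (F : finFieldType) (G : set 'M[laurent F]_2).
Hypothesis pglG : pgl_subgroup G.
Local Notation K := (laurent F).
Implicit Types (g h : 'M[K]_2) (x y z : vclass F).

Lemma pgl_unit g : G g -> g \in unitmx.
Proof. by case: pglG => + _ _ _; exact. Qed.

Lemma pgl_mul g h : G g -> G h -> G (g *m h).
Proof. by case: pglG => _ _ + _; exact. Qed.

Lemma pgl_inv g : G g -> G (invmx g).
Proof. by case: pglG => _ _ _; exact. Qed.

Lemma pgl1 : G 1%:M.
Proof. by case: pglG => _ + _ _; apply; exact: oner_neq0. Qed.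

Lemma orb_sym x y : orb G x y -> orb G y x.
Proof.
move=> [g Gg <-]; exists (invmx g); first exact: pgl_inv.
exact: actK (pgl_unit Gg).
Qed.

Lemma orb_trans x y z : orb G x y -> orb G y z -> orb G x z.
Proof.
move=> [g Gg <-] [h Gh <-]; exists (h *m g); first exact: pgl_mul.
exact: actM.
Qed.

Lemma stab_mul x g h : stab G x g -> stab G x h -> stab G x (g *m h).
Proof. by move=> [Gg gx] [Gh hx]; split; [exact: pgl_mul|rewrite actM hx gx]. Qed.

Lemma stab_inv x g : stab G x g -> stab G x (invmx g).
Proof.
move=> [Gg gx]; split; first exact: pgl_inv.
by rewrite -{1}gx (actK _ (pgl_unit Gg)).
Qed.

Lemma stab1 x : stab G x 1%:M.
Proof. by split; [exact: pgl1|exact: act1]. Qed.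

Lemma mem_stab_orb x y : orb (stab G x) y y.
Proof. by exists 1%:M; [exact: stab1|exact: act1]. Qed.

Lemma eq_stab_orb x y z : orb (stab G x) y z -> orb (stab G x) z = orb (stab G x) y.
Proof.
move=> [g sg <-]; apply/seteqP; split => _ [h sh <-].
  by exists (h *m g); [exact: stab_mul|exact: actM].
exists (h *m invmx g); first exact: stab_mul (stab_inv sg).
by rewrite actM (actK _ (pgl_unit sg.1)).
Qed.

Definition nbrs x : set (vclass F) := [set y | tree_vertex y /\ tree_adj x y].

Lemma stab_orb_nbrs x y : nbrs x y -> orb (stab G x) y `<=` nbrs x.
Proof.
move=> [vy xy] _ [g [Gg gx] <-]; split; first exact: act_vertex (pgl_unit Gg) vy.
by rewrite -gx; exact: act_adj (pgl_unit Gg) xy.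
Qed.

(** This is the orbit-stabilizer correspondence: [f] sends a point of the orbit of [y] to the coset
    of elements carrying [y] there. *)
Lemma edge_index_orb x y : tree_vertex x -> nbrs x y ->
  edge_index G x y = ncard (orb (stab G x) y).
Proof.
move=> vx xy.
pose f y' : set 'M[K]_2 := [set g | stab G x g /\ act g y = y'].
have fE g : stab G x g ->
    f (act g y) = [set g *m h | h in stab (stab G x) y].
  move=> sg; apply/seteqP; split => [g' [sg' g'y]|_ [h [sh hy] <-]].
    exists (invmx g *m g'); last by rewrite (mulKVmx (pgl_unit sg.1)).
    split; first exact: stab_mul (stab_inv sg) sg'.
    by rewrite actM g'y (actK _ (pgl_unit sg.1)).
  by split; [exact: stab_mul|rewrite actM hy].
rewrite /edge_index /gindex -(@ncard_bij _ _ _ f).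
- congr ncard; apply/seteqP; split => [_ [g sg <-]|_ [_ [g sg <-] <-]].
    by exists (act g y); [exists g|exact: fE].
  by exists g => //; rewrite fE.
- exact: sub_finite_set (stab_orb_nbrs xy) (finite_neighbors vx).
- move=> y1 y2 /set_mem[g sg <-] _ ff.
  have : f (act g y) g by split.
  by rewrite ff => -[].
Qed.

(** A device for double counting: modulo scalars it fibres over the neighbours of [x] in the orbit
    of [z], and inversion exchanges the roles of [x] and [z]. *)
Definition transporter x z : set 'M[K]_2 := [set g | G g /\ tree_adj x (act g z)].

Lemma mem_pgl_class c g : c != 0 -> pgl_class g (c *: g).
Proof. by exists c. Qed.

Lemma pgl_class_refl g : pgl_class g g.
Proof. by rewrite -{2}[g]scale1r; exact: mem_pgl_class (oner_neq0 _). Qed.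

(** Scalars fix every vertex, so on classes of invertible matrices the chosen representative does
    not matter. *)
Definition act_class (P : set 'M[K]_2) z : vclass F := act (xget 0 P) z.

Lemma act_classE g z : tree_vertex z -> g \in unitmx -> act_class (pgl_class g) z = act g z.
Proof.
move=> vz ug; rewrite /act_class; case: xgetP => [_ _ [c /= c0 <-]|/(_ g)].
  exact: act_scale vz c0 ug.
by case; exact: pgl_class_refl.
Qed.

Lemma pgl_class_mul g h : [set g *m p | p in pgl_class h] = pgl_class (g *m h).
Proof.
apply/seteqP; split => [_ [_ [c c0 <-] <-]|_ [c c0 <-]].
  by exists c => //; exact: scalemxAr.
by exists (c *: h); [exists c|rewrite -scalemxAr].
Qed.

Lemma pgl_class_inv g : g \in unitmx ->
  [set invmx p | p in pgl_class g] = pgl_class (invmx g).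
Proof.
move=> ug; have inv c : c != 0 -> invmx (c *: g) = c^-1 *: invmx g.
  by move=> c0; apply: invmxZ; exact: unitmx_scale c0 ug.
apply/seteqP; split => [_ [_ [c c0 <-] <-]|_ [c c0 <-]].
  by rewrite (inv _ c0); exact: mem_pgl_class (invr_neq0 c0).
exists (c^-1 *: g); first exact: mem_pgl_class (invr_neq0 c0).
by rewrite (inv _ (invr_neq0 c0)) invrK.
Qed.

(** * Counting transporters by their fibres *)

Section Transporters.
Variables x z : vclass F.
Hypotheses (vx : tree_vertex x) (vz : tree_vertex z).
Hypothesis finz : finite_set (@pgl_class F @` stab G z).

Let X := @pgl_class F @` transporter x z.

Lemma act_class_conn : (fun P => act_class P z) @` X = nbrs x `&` orb G z.
Proof.
apply/seteqP; split => [_ [_ [g [Gg xgz] <-] <-]|y [[vy xy] [g Gg gz]]].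
  rewrite (act_classE vz (pgl_unit Gg)); split; last by exists g.
  by split => //; exact: act_vertex (pgl_unit Gg) vz.
exists (pgl_class g); first by exists g => //; split => //; rewrite gz.
by rewrite (act_classE vz (pgl_unit Gg)).
Qed.

(** Two transporters move [z] to the same vertex exactly when they differ by a stabilizer element on
    the right, so each fibre is a coset of the stabilizer of [z]. *)
Lemma conn_fiber g : transporter x z g ->
  X `&` (fun P => act_class P z) @^-1` [set act g z] =
  (fun P => [set g *m p | p in P]) @` (@pgl_class F @` stab G z).
Proof.
move=> [Gg xgz]; have ug := pgl_unit Gg.
apply/seteqP; split => [_ [[g' [Gg' xg'z] <-] /=]|_ [_ [h [Gh hz] <-] <-]].
  rewrite (act_classE vz (pgl_unit Gg')) => g'z.
  exists (pgl_class (invmx g *m g')).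
    exists (invmx g *m g') => //; split; first exact: pgl_mul (pgl_inv Gg) Gg'.
    by rewrite actM g'z (actK _ ug).
  by rewrite pgl_class_mul (mulKVmx ug).
rewrite pgl_class_mul; split.
  by exists (g *m h) => //; split; [exact: pgl_mul|rewrite actM hz].
by rewrite /= (act_classE vz (pgl_unit (pgl_mul Gg Gh))) actM hz.
Qed.

Lemma finite_conn : finite_set X.
Proof.
have finN : finite_set (nbrs x `&` orb G z).
  by apply: finite_setIl; exact: finite_neighbors.
have -> : X = \bigcup_(y in nbrs x `&` orb G z)
    (X `&` (fun P => act_class P z) @^-1` [set y]).
  apply/seteqP; split => [P XP|P [y _ []]//].
  by exists (act_class P z) => //; rewrite -act_class_conn; exists P.
apply: bigcup_finite => // y; rewrite -act_class_conn => -[_ [g cg <-] <-].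
by rewrite (act_classE vz (pgl_unit cg.1)) (conn_fiber cg); exact: finite_image.
Qed.

Lemma ncard_conn : ncard X = (ncard (nbrs x `&` orb G z) * pgl_order (stab G z))%N.
Proof.
apply: ncard_fiber finite_conn act_class_conn _ => y.
rewrite -act_class_conn => -[_ [g cg <-] <-].
rewrite (act_classE vz (pgl_unit cg.1)) (conn_fiber cg).
apply: ncard_bij => // P Q _ _ PQ; have ug := pgl_unit cg.1.
have gK (P' : set 'M[K]_2) : [set invmx g *m p | p in [set g *m p | p in P']] = P'.
  rewrite image_comp (_ : _ \o _ = id) ?image_id //.
  by apply/funext => p; exact: mulKmx ug p.
by rewrite -(gK P) PQ gK.
Qed.

End Transporters.

Lemma conn_inv x z : tree_vertex x -> tree_vertex z ->
  (fun P => [set invmx p | p in P]) @` (@pgl_class F @` transporter x z) =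
  @pgl_class F @` transporter z x.
Proof.
have sub x' z' : tree_vertex x' -> forall g, transporter x' z' g -> transporter z' x' (invmx g).
  move=> vx g [Gg xgz]; split; first exact: pgl_inv.
  by have := act_adj (pgl_unit (pgl_inv Gg)) (adj_sym vx xgz); rewrite (actK _ (pgl_unit Gg)).
move=> vx vz; apply/seteqP; split => [_ [_ [g cg <-] <-]|_ [g cg <-]].
  by rewrite (pgl_class_inv (pgl_unit cg.1)); exists (invmx g) => //; exact: sub.
exists (pgl_class (invmx g)); first by exists (invmx g) => //; exact: sub.
by rewrite (pgl_class_inv (invmx_unit (pgl_unit cg.1))) invmxK.
Qed.

(** Both sides count transporters modulo scalars, one from each end; inversion matches them
    bijectively. *)
Lemma nbrs_orb_sym x z : tree_vertex x -> tree_vertex z ->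
  finite_set (@pgl_class F @` stab G x) -> finite_set (@pgl_class F @` stab G z) ->
  (ncard (nbrs x `&` orb G z) * pgl_order (stab G z) =
   ncard (nbrs z `&` orb G x) * pgl_order (stab G x))%N.
Proof.
move=> vx vz finx finz; rewrite -!ncard_conn // -(conn_inv vx vz).
rewrite (ncard_bij (finite_conn vx vz finz)) //.
move=> P Q _ _ PQ.
have invK (P' : set 'M[K]_2) : [set invmx p | p in [set invmx p | p in P']] = P'.
  rewrite image_comp (_ : _ \o _ = id) ?image_id //.
  by apply/funext => p; exact: invmxK.
by rewrite -(invK P) PQ invK.
Qed.

Lemma pgl_order_gt0 x : finite_set (@pgl_class F @` stab G x) -> (0 < pgl_order (stab G x))%N.
Proof.
move=> finx; rewrite /pgl_order /ncard cardfs_gt0; apply/fset0Pn.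
exists (pgl_class 1%:M); rewrite in_fset_set //; apply/mem_set.
by exists 1%:M => //; exact: stab1.
Qed.

End LatticeAction.

(** * The adjacency operator of the quotient *)

Section QuotientAdjacency.
Variables (R : realType) (F : finFieldType) (d r : nat).
Variables (G : set 'M[laurent F]_2) (lift : qvert d r -> vclass F) (w : 'I_r -> R).
Hypothesis pglG : pgl_subgroup G.
Hypothesis finG : forall x, tree_vertex x -> finite_set (@pgl_class F @` stab G x).
Hypothesis cuspG : cusp_decomposition G lift w.
Local Notation C := (Cx R).
Local Notation Y := (qvert d r).
Implicit Types (u v : Y) (f : Y -> C) (c : 'I_r).

Let vlift v : tree_vertex (lift v) := cd_vertex cuspG v.

Definition nbr_count v u : nat := ncard (nbrs (lift v) `&` orb G (lift u)).

Lemma pullbackE f u y : orb G (lift u) y -> pullback G lift f y = f u.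
Proof.
move=> uy; rewrite /pullback; case: xgetP => [_ _ [v vy <-]|/(_ (f u))].
  by congr f; apply: (cd_inj cuspG); exact: (orb_trans pglG vy (orb_sym pglG uy)).
by case; exists u.
Qed.

Lemma finite_nbrs v : finite_set (nbrs (lift v)).
Proof. exact: finite_neighbors (vlift v). Qed.

(** The index of an edge stabilizer is the size of the edge orbit and the pullback is constant on
    orbits, so the weighted sum over orbits unfolds to a plain sum over neighbours in the tree. *)
Lemma adjacencyE f v : adjacency G lift f v =
  \sum_(y <- fset_set (nbrs (lift v))) pullback G lift f y.
Proof.
have finN := finite_nbrs v.
rewrite /adjacency -[edge_orbits _ _]/((orb (stab G (lift v))) @` nbrs (lift v)).
rewrite fsbig_finite; last exact: finite_image.
rewrite (sum_fset_fiber (orb (stab G (lift v))) _ finN).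
apply: eq_big_seq => X; rewrite in_fset_set; last exact: finite_image.
move=> /set_mem[y0 Ny0 y0X].
have Xrep : X (representative X).
  by apply: xgetPex; exists y0; rewrite -y0X; exact: mem_stab_orb.
have XE y : X y -> orb (stab G (lift v)) y = X.
  by rewrite -y0X => y0y; exact: eq_stab_orb.
have XN : X `<=` nbrs (lift v) by rewrite -y0X; exact: stab_orb_nbrs.
have -> : nbrs (lift v) `&` orb (stab G (lift v)) @^-1` [set X] = X.
  apply/seteqP; split => [y [_ /= <-]|y Xy]; first exact: mem_stab_orb.
  by split; [exact: XN|exact: XE].
rewrite (edge_index_orb pglG (vlift v) (XN _ Xrep)) (XE _ Xrep).
have finX : finite_set X by exact: sub_finite_set XN finN.
rewrite (eq_big_seq (fun=> pullback G lift f (representative X))) => [|y]; last first.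
  rewrite in_fset_set // => /set_mem Xy.
  have [u uy] := cd_surj cuspG (XN _ Xy).1.
  rewrite (pullbackE f uy); apply/esym/pullbackE; apply: (orb_trans pglG uy).
  by move: Xrep; rewrite -(XE _ Xy) => -[g [Gg _] <-]; exists g.
by rewrite big_const_seq count_predT iter_addr_0 mulr_natl.
Qed.

Lemma pullback_delta (k : Y -> C) u y : tree_vertex y ->
  pullback G lift (fun v => k v * qdelta R u v) y = k u * (`[< orb G (lift u) y >])%:R.
Proof.
move=> vy; have [v vyy] := cd_surj cuspG vy.
rewrite (pullbackE _ vyy) /qdelta; have [e|vu] := eqVneq v u.
  by rewrite -e asboolT.
rewrite asboolF ?mulr0 // => uy; case/eqP: vu; apply: (cd_inj cuspG).
exact: (orb_trans pglG vyy (orb_sym pglG uy)).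
Qed.

(** The factor [k] leaves room for the weight of [Uinv]; with [k = 1] the lemma reads off the matrix
    entries of the adjacency operator. *)
Lemma adjacency_delta (k : Y -> C) u v :
  adjacency G lift (fun v => k v * qdelta R u v) v = k u * (nbr_count v u)%:R.
Proof.
have finN := finite_nbrs v.
rewrite adjacencyE (eq_big_seq (fun y => k u * (`[< orb G (lift u) y >])%:R)); last first.
  by move=> y; rewrite in_fset_set // => /set_mem[vy _]; exact: pullback_delta.
rewrite -mulr_sumr -natr_sum; congr (_ * _%:R).
rewrite -(@big_mkcond _ _ addn _ _ _ (fun=> 1%N)) sum1_count -size_filter.
apply/perm_size/uniq_perm; rewrite ?filter_uniq ?fset_uniq // => y.
rewrite mem_filter !in_fset_set //; last exact: finite_setIl.
apply/andP/idP => [[/asboolP uy /set_mem Ny]|/set_mem[Ny uy]]; first exact/mem_set.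
by split; [exact/asboolP|exact/mem_set].
Qed.

Lemma nbr_count_gt0 v u y : nbrs (lift v) y -> orb G (lift u) y -> (0 < nbr_count v u)%N.
Proof.
move=> Ny uy; rewrite /nbr_count /ncard cardfs_gt0; apply/fset0Pn.
exists y; rewrite in_fset_set; first exact/mem_set.
exact: finite_setIl (finite_nbrs v).
Qed.

Lemma qweight_gt0 v : 0 < qweight R G lift v.
Proof. by rewrite invr_gt0 ltr0n pgl_order_gt0 //; exact: finG. Qed.

(** This detailed balance is the self-adjointness of the adjacency operator on [L^2(Y, lambda)]; it
    is [nbrs_orb_sym] divided by both stabilizer orders. *)
Lemma qweight_nbr_count u v :
  qweight R G lift v * (nbr_count v u)%:R = qweight R G lift u * (nbr_count u v)%:R.
Proof.
have e := nbrs_orb_sym pglG (vlift v) (vlift u) (finG (vlift v)) (finG (vlift u)).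
have := qweight_gt0 u; have := qweight_gt0 v.
rewrite /qweight !invr_gt0 => v0 u0.
have {}e := congr1 (fun n => n%:R : R) e; rewrite /= !natrM in e.
apply: (mulIf (lt0r_neq0 u0)); rewrite -mulrA e.
by field; rewrite !lt0r_neq0.
Qed.

Lemma nbr_count_eq0 u v : nbr_count u v = 0%N -> nbr_count v u = 0%N.
Proof.
move=> uv0; have := qweight_nbr_count u v; rewrite uv0 mulr0 => /eqP.
by rewrite mulf_eq0 gt_eqF ?qweight_gt0 //= pnatr_eq0 => /eqP.
Qed.

(** Applied to the delta function of a core vertex, the cusp recursion at [(c, n)] gives [0]; the
    balance of weights transfers this to the opposite direction. *)
Lemma nbr_count_core_ray i c n : (2 <= n)%N -> nbr_count (core i) (ray c n) = 0%N.
Proof.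
move=> n2; apply: nbr_count_eq0; apply/eqP; rewrite -(pnatr_eq0 C).
have := adjacency_delta (fun=> 1) (core i) (ray c n); rewrite mul1r => <-.
by rewrite (cd_adjacency cuspG) // /qdelta /= !mulr0 addr0.
Qed.

(** Of the neighbours of a lift of [(c, 1)], only the distinguished [y] does not lie over the core,
    and it lies over [(c, 2)]. *)
Lemma nbr_count_ray1 c u : ~ (exists i, u = core i) ->
  nbr_count (ray c 1) u = (u == ray c 2).
Proof.
move=> nu; have [y [adjy ry _ other]] := cd_first cuspG c.
have vy : tree_vertex y by case: ry => g Gg <-; exact: act_vertex (pgl_unit pglG Gg) (vlift _).
rewrite /nbr_count; have -> : nbrs (lift (ray c 1)) `&` orb G (lift u) =
    if u == ray c 2 then [set y] else set0.
  have zy z : nbrs (lift (ray c 1)) z -> orb G (lift u) z -> z = y.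
    move=> [vz adjz] uz; apply: contrapT => zy; have [i iz] := other z vz adjz zy.
    by apply: nu; exists i; apply: (cd_inj cuspG); exact: (orb_trans pglG uz (orb_sym pglG iz)).
  have [uE|u2] := eqVneq u (ray c 2); apply/seteqP; split=> z.
  - by move=> [Nz uz]; exact: zy.
  - by move=> ->; rewrite uE; split.
  - move=> [Nz uz]; case/eqP: u2; apply: (cd_inj cuspG).
    by apply: (orb_trans pglG uz); rewrite (zy z Nz uz); exact: (orb_sym pglG ry).
  - by [].
case: eqP => _; first by rewrite /ncard fset_set1 cardfs1.
by rewrite /ncard fset_set0 cardfs0.
Qed.

(** Both sides are sums over neighbours in the tree and are compared term by term; a neighbour
    beyond the first vertex of a ray is excluded by [nbr_count_core_ray]. *)
Lemma adjacency_core f i : adjacency G lift f (core i) =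
  \sum_j f (core j) * (nbr_count (core i) (core j))%:R +
  \sum_c f (ray c 1) * (nbr_count (core i) (ray c 1))%:R.
Proof.
under eq_bigr do rewrite -adjacency_delta adjacencyE.
under [X in _ + X]eq_bigr do rewrite -adjacency_delta adjacencyE.
rewrite adjacencyE exchange_big /= [X in _ + X]exchange_big /= -big_split /=.
apply: eq_big_seq => y; rewrite in_fset_set; last exact: finite_nbrs.
move=> /set_mem Ny; have [u uy] := cd_surj cuspG Ny.1.
under eq_bigr do rewrite (pullbackE _ uy).
under [X in _ + X]eq_bigr do rewrite (pullbackE _ uy).
rewrite (pullbackE _ uy) /qdelta.
case: u uy => [j|[c [|m]]] uy.
- rewrite [X in _ + X]big1 ?addr0 => [|c _]; last by rewrite mulr0.
  rewrite (bigD1 j) //= eqxx mulr1 big1 ?addr0 // => k /negbTE kj.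
  by rewrite /core (inj_eq inl_inj) eq_sym kj mulr0.
- rewrite big1 ?add0r => [|k _]; last by rewrite mulr0.
  rewrite (bigD1 c) //= eqxx mulr1 big1 ?addr0 // => k /negbTE kc.
  by rewrite /ray (inj_eq inr_inj) xpair_eqE eq_sym kc mulr0.
- by have := nbr_count_gt0 Ny uy; rewrite -[inr _]/(ray c m.+2) nbr_count_core_ray.
Qed.

Lemma adjacency_ray1 f c : adjacency G lift f (ray c 1) =
  \sum_j f (core j) * (nbr_count (ray c 1) (core j))%:R + f (ray c 2).
Proof.
have -> : f (ray c 2) = f (ray c 2) * (nbr_count (ray c 1) (ray c 2))%:R.
  by rewrite nbr_count_ray1 ?eqxx ?mulr1 // => -[].
under eq_bigr do rewrite -adjacency_delta adjacencyE.
rewrite -adjacency_delta !adjacencyE exchange_big /= -big_split /=.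
apply: eq_big_seq => y; rewrite in_fset_set; last exact: finite_nbrs.
move=> /set_mem Ny; have [u uy] := cd_surj cuspG Ny.1.
under eq_bigr do rewrite (pullbackE _ uy).
rewrite !(pullbackE _ uy) /qdelta.
have := nbr_count_gt0 Ny uy; case: u uy => [j|cm] uy N0.
- rewrite mulr0 addr0.
  rewrite (bigD1 j) //= eqxx mulr1 big1 ?addr0 // => k /negbTE kj.
  by rewrite /core (inj_eq inl_inj) eq_sym kj mulr0.
- rewrite big1 ?add0r => [|k _]; last by rewrite mulr0.
  move: N0; rewrite nbr_count_ray1; last by case.
  by case: (_ == _) => // _; rewrite mulr1.
Qed.

(** * Matrix entries of [J] and its rows at the core and at the first ray vertices *)

Let sq v : C := (Num.sqrt (qweight R G lift v))%:C.

Let sq_neq0 v : sq v != 0.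
Proof. by rewrite (fmorph_eq0 (real_complex R)) gt_eqF // sqrtr_gt0 qweight_gt0. Qed.

Let sq_sqr v : sq v ^+ 2 = (qweight R G lift v)%:C.
Proof. by rewrite /sq -rmorphXn /= sqr_sqrtr // ltW // qweight_gt0. Qed.

Lemma Jop_delta u v :
  Jop G lift (qdelta R u) v = sq v * (nbr_count v u)%:R / sq u.
Proof.
rewrite /Jop /Uop -/(sq v) -mulrA; congr (_ * _).
rewrite -[Uinv _ _ _]/(fun v' => (sq v')^-1 * qdelta R u v') adjacency_delta.
exact: mulrC.
Qed.

Lemma Jop_delta_sym u v : Jop G lift (qdelta R u) v = Jop G lift (qdelta R v) u.
Proof.
rewrite !Jop_delta.
have : sq v ^+ 2 * (nbr_count v u)%:R = sq u ^+ 2 * (nbr_count u v)%:R.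
  by have := congr1 (real_complex R) (qweight_nbr_count u v);
     rewrite !rmorphM /= !rmorph_nat -!sq_sqr.
move=> e; apply: (mulIf (mulf_neq0 (sq_neq0 u) (sq_neq0 v))).
have -> : sq v * (nbr_count v u)%:R / sq u * (sq u * sq v) = sq v ^+ 2 * (nbr_count v u)%:R.
  by field; exact: sq_neq0.
by rewrite e; field; exact: sq_neq0.
Qed.

Lemma conj_Jop_delta u v : Num.conj (Jop G lift (qdelta R u) v) = Jop G lift (qdelta R u) v.
Proof.
rewrite Jop_delta /sq !rmorphM /= fmorphV rmorph_nat.
by rewrite !conj_realC; congr (_ / _); exact: conj_realC.
Qed.

Lemma adjoint_coreH : adjoint (coreH R G lift) = coreH R G lift.
Proof. by apply/matrixP => i j; rewrite !mxE conj_Jop_delta Jop_delta_sym. Qed.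

Definition core_part f : 'cV[C]_d := \col_i Uop G lift f (core i).

Definition ray_part f n : 'cV[C]_r := \col_c Uop G lift f (ray c n).

Lemma Jop_core f :
  coreH R G lift *m core_part f + coreV R G lift *m ray_part f 1 =
  core_part (adjacency G lift f).
Proof.
apply/colP => i; rewrite !mxE /Uop adjacency_core mulrDr !mulr_sumr.
congr (_ + _); apply: eq_bigr => j _; rewrite !mxE Jop_delta /Uop -!/(sq _).
  by field; exact: sq_neq0.
by field; exact: sq_neq0.
Qed.

(** The weights drop by the factor [q] along a ray, so conjugation by [U] turns the edge of index
    one from [(c, 1)] to [(c, 2)] into the entry [a] of [J]. *)
Lemma sq_ray c : sqrtq R F * sq (ray c 2) = sq (ray c 1).
Proof.
rewrite /sq /sqrtq -rmorphM /= -sqrtrM ?ler0n //; congr (Num.sqrt _)%:C.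
rewrite !(cd_weight cuspG) // expr1 expr2 invfM.
have q0 : #|F|%:R != 0 :> R by rewrite pnatr_eq0 -lt0n (ltn_trans _ (cardF_gt1 F)).
by field.
Qed.

Lemma Jop_ray1 f :
  adjoint (coreV R G lift) *m core_part f + sqrtq R F *: ray_part f 2 =
  ray_part (adjacency G lift f) 1.
Proof.
apply/colP => c; rewrite !mxE /Uop adjacency_ray1 -!/(sq _) mulrDr mulrA sq_ray.
congr (_ + _); rewrite mulr_sumr; apply: eq_bigr => i _.
rewrite !mxE conj_Jop_delta Jop_delta_sym Jop_delta /Uop -!/(sq _).
by field; exact: sq_neq0.
Qed.

End QuotientAdjacency.

(** * The scattering matrix *)

Section ScatteringMatrix.
Variables (R : realType) (F : finFieldType) (d r : nat).
Variables (G : set 'M[laurent F]_2) (lift : qvert d r -> vclass F) (w : 'I_r -> R).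
Hypothesis pglG : pgl_subgroup G.
Hypothesis finG : forall x, tree_vertex x -> finite_set (@pgl_class F @` stab G x).
Hypothesis cuspG : cusp_decomposition G lift w.
Local Notation C := (Cx R).
Local Notation Y := (qvert d r).
Local Notation a := (sqrtq R F).
Local Notation H := (coreH R G lift).
Local Notation V := (coreV R G lift).
Local Notation Fm := (@Fmx R F d r G lift).
Local Notation Sm := (@Smx R F d r G lift).
Implicit Types (f : Y -> C) (z s : C).

Lemma xparV z : xpar F z^-1 = xpar F z.
Proof. by rewrite /xpar invrK addrC. Qed.

Lemma adjointM m n p (A : 'M[C]_(m, n)) (B : 'M[C]_(n, p)) :
  adjoint (A *m B) = adjoint B *m adjoint A.
Proof. by rewrite /adjoint trmx_mul map_mxM. Qed.

Lemma adjointD m n (A B : 'M[C]_(m, n)) : adjoint (A + B) = adjoint A + adjoint B.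
Proof. by rewrite /adjoint linearD /= map_mxD. Qed.

Lemma adjointN m n (A : 'M[C]_(m, n)) : adjoint (- A) = - adjoint A.
Proof. by rewrite /adjoint linearN /= map_mxN. Qed.

Lemma adjointZ m n (c : C) (A : 'M[C]_(m, n)) : adjoint (c *: A) = Num.conj c *: adjoint A.
Proof. by rewrite /adjoint linearZ /= map_mxZ. Qed.

Lemma adjointK m n (A : 'M[C]_(m, n)) : adjoint (adjoint A) = A.
Proof. by apply/matrixP => i j; rewrite !mxE conjCK. Qed.

Lemma adjoint_scalar n (c : C) : adjoint (c%:M : 'M[C]_n) = (Num.conj c)%:M.
Proof. by rewrite /adjoint tr_scalar_mx map_scalar_mx. Qed.

Lemma adjoint_inv n (A : 'M[C]_n) : adjoint (invmx A) = invmx (adjoint A).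
Proof. by rewrite /adjoint trmx_inv map_invmx. Qed.

Lemma conj_sqrtq : Num.conj a = a.
Proof. exact: conj_realC. Qed.

Lemma conj_mulq z : Num.conj (a * z) = a * Num.conj z.
Proof. by rewrite rmorphM; congr (_ * _); exact: conj_sqrtq. Qed.

Lemma conj_divq z : Num.conj (z / a) = Num.conj z / a.
Proof. by rewrite rmorphM fmorphV; congr (_ / _); exact: conj_sqrtq. Qed.

Lemma adjoint_Fmx z : adjoint (Fm z) = Fm (Num.conj z).
Proof.
rewrite /Fmx !adjointD adjointN (adjoint_coreH pglG finG cuspG) adjoint_scalar.
by rewrite adjointZ adjointM adjointK conj_divq /xpar conj_mulq rmorphD !fmorphV.
Qed.

Lemma adjoint_Smx z : adjoint (Sm z) = Sm (Num.conj z).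
Proof.
rewrite /Smx adjointD adjointN adjoint_scalar rmorph1 adjointZ !adjointM adjointK.
by rewrite adjoint_inv adjoint_Fmx mulmxA conj_divq rmorphB !fmorphV.
Qed.

(** Since [x(z)] is invariant under inversion, [F(1/z)] and [F(z)] differ only by [k V V^*], and the
    resolvent identity applies. *)
Lemma Smx_mulV z : z != 0 -> Fm z \in unitmx -> Fm z^-1 \in unitmx ->
  Sm z^-1 *m Sm z = 1%:M.
Proof.
move=> z0 uF uF'; pose k := (z - z^-1) / a.
have SE : Sm z = - 1%:M - k *: (adjoint V *m invmx (Fm z) *m V).
  by rewrite /Smx -scaleNr /k -mulNr opprB.
have SE' : Sm z^-1 = - 1%:M + k *: (adjoint V *m invmx (Fm z^-1) *m V).
  by rewrite /Smx invrK.
have FF : Fm z^-1 = Fm z + k *: (V *m adjoint V).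
  rewrite /Fmx xparV invrK -[RHS]addrA -scalerDl; congr (_ + _ *: _).
  by rewrite /k -mulrDl addrC subrK.
have e : invmx (Fm z) - invmx (Fm z^-1) =
    k *: (invmx (Fm z^-1) *m (V *m adjoint V) *m invmx (Fm z)).
  have {1}-> : invmx (Fm z) = invmx (Fm z^-1) *m (Fm z^-1 *m invmx (Fm z)).
    by rewrite mulKmx.
  rewrite {2}FF mulmxDl mulmxV // mulmxDr mulmx1 addrAC subrr add0r.
  by rewrite -scalemxAl -scalemxAr mulmxA.
(* Sandwiched between [V^*] and [V], the resolvent identity becomes [A - B = k B A], which is
   exactly what makes [(-1 + k B)(-1 - k A)] equal to [1]. *)
have e2 : adjoint V *m invmx (Fm z) *m V - adjoint V *m invmx (Fm z^-1) *m V =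
    k *: ((adjoint V *m invmx (Fm z^-1) *m V) *m (adjoint V *m invmx (Fm z) *m V)).
  rewrite -mulmxBl -mulmxBr e -scalemxAr -scalemxAl; congr (_ *: _).
  by rewrite !mulmxA.
rewrite SE SE'; set A := adjoint V *m invmx (Fm z) *m V in e2 *.
set B := adjoint V *m invmx (Fm z^-1) *m V in e2 *.
have XY : (k *: B) *m (k *: A) = k *: A - k *: B.
  by rewrite -scalemxAl -scalemxAr -scalerBr e2.
rewrite mulmxDl !mulmxBr XY !mulNmx !mulmxN !mulmx1 !mul1mx !opprK.
by rewrite opprB addKr addrK.
Qed.

Lemma scattering_relation f z (p p' : 'cV[C]_r) : z != 0 -> Fm z \in unitmx ->
  (forall v, adjacency G lift f v = xpar F z * f v) ->
  amplitudes z (Uop G lift f) p p' -> p' = Sm z *m p.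
Proof.
move=> z0 uF eigf ampf; have a0 := sqrtq_neq0 R F.
have rayE n : (1 <= n)%N -> ray_part G lift f n = z ^+ n *: p + z ^- n *: p'.
  by move=> n1; apply/colP => c; rewrite !mxE ampf // ![_ * z ^+ _]mulrC ![_ * z ^- _]mulrC.
have eigU v : Uop G lift (adjacency G lift f) v = xpar F z * Uop G lift f v.
  by rewrite /Uop eigf mulrCA.
have := Jop_core pglG finG cuspG f; have := Jop_ray1 pglG finG cuspG f.
have -> : ray_part G lift (adjacency G lift f) 1 = xpar F z *: ray_part G lift f 1.
  by apply/colP => c; rewrite !mxE eigU.
have -> : core_part G lift (adjacency G lift f) = xpar F z *: core_part G lift f.
  by apply/colP => c; rewrite !mxE eigU.
rewrite !rayE //; set u := core_part G lift f => J1 J0.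
(* The core term stands in for [a] times the value of [p z^n + p' z^-n] at [n = 0]. *)
have Vu : adjoint V *m u = a *: (p + p').
  apply/colP => c; have /colP/(_ c) := J1; rewrite !mxE => /(canRL (addrK _)) ->.
  by rewrite /xpar expr1; field; rewrite z0.
(* The term [z^-1 / a V V^*] in [F] is there to cancel the outgoing amplitude [p'], leaving an
   equation in [p] alone. *)
have Fu : Fm z *m u = (z^-1 - z) *: (V *m p).
  rewrite /Fmx mulmxDl mulmxBl mul_scalar_mx -scalemxAl -mulmxA Vu.
  rewrite (canRL (addrK _) J0) -scalemxAr scalerA divfK //.
  rewrite mulmxDr -!scalemxAr mulmxDr; apply/colP => i.
  rewrite !(mxE _ _ i) expr1; ring.
have uE : u = (z^-1 - z) *: (invmx (Fm z) *m V *m p).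
  by rewrite -[u](mulKmx uF) Fu -scalemxAr mulmxA.
rewrite /Smx mulmxDl mulNmx mul1mx -scalemxAl.
have -> : adjoint V *m invmx (Fm z) *m V *m p = adjoint V *m (invmx (Fm z) *m V *m p).
  by rewrite !mulmxA.
rewrite [_ / a]mulrC -scalerA scalemxAr -uE Vu scalerA mulVf // scale1r.
by rewrite addrA addNr add0r.
Qed.

Lemma horner_det n (M : 'M[{poly C}]_n) (y : C) :
  (\det M).[y] = \det (map_mx (fun p : {poly C} => p.[y]) M).
Proof. by rewrite -[LHS]/(horner_eval y _) -det_map_mx. Qed.

(* [F(z) = z P(1/z)] with [P(0) = - a I], so [det P] is a nonzero polynomial. *)
Lemma discrete_quadratic_singular n (A B : 'M[C]_n) :
  discrete [set s : C | A - (xpar F (zeta F s))%:M + ((zeta F s)^-1 / a) *: B \notin unitmx].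
Proof.
have a0 := sqrtq_neq0 R F.
pose M : 'M[{poly C}]_n := \matrix_(i, j)
  ((- a *+ (i == j))%:P + 'X * (A i j)%:P + 'X^2 * (B i j / a - a *+ (i == j))%:P).
have ME z : z != 0 -> A - (xpar F z)%:M + (z^-1 / a) *: B =
    z *: map_mx (fun p : {poly C} => p.[z^-1]) M.
  move=> z0; apply/matrixP => i j; rewrite !mxE !hornerE /xpar.
  by case: (i == j); rewrite ?mulr1n ?mulr0n; field; rewrite z0 a0.
have M0 : \det M != 0.
  apply/eqP => M0; have := horner_det M 0; rewrite M0 horner0.
  have -> : map_mx (fun p : {poly C} => p.[0]) M = (- a)%:M.
    apply/matrixP => i j; rewrite !mxE !hornerE.
    by case: (i == j); rewrite ?mulr1n ?mulr0n; ring.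
  by rewrite det_scalar => /esym/eqP; rewrite expf_eq0 oppr_eq0 (negbTE a0) andbF.
have dz (c : C) : discrete [set s | (zeta F s)^-1 = c].
  apply: (sub_discrete _ (discrete_qpow_level F (a / c))) => s /= <-.
  by rewrite zetaE invrK mulrC divfK.
apply: (sub_discrete _ (discrete_root M0 dz)) => s /=.
rewrite (ME _ (zeta_neq0 F s)) unitmxZ ?unitfE ?zeta_neq0 // unitmxE unitfE negbK.
by rewrite /root horner_det.
Qed.

Lemma discrete_Fmx_singular : discrete [set s : C | Fm (zeta F s) \notin unitmx].
Proof. exact: discrete_quadratic_singular. Qed.

Lemma mx_holomorphic_Fmx s : mx_holomorphic_at (fun s => Fm (zeta F s)) s.
Proof.
apply: mx_holomorphicD; last first.
  apply: mx_holomorphicZ; last exact: mx_holomorphic_cst.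
  exact: holomorphicM (holomorphic_zetaV F s) (holomorphic_cst _ s).
apply: mx_holomorphicD; first exact: mx_holomorphic_cst.
move=> i j; under eq_fun do rewrite !mxE -mulNrn -mulr_natr.
apply: holomorphicM; last exact: holomorphic_cst.
apply: holomorphicN; apply: holomorphicM; first exact: holomorphic_cst.
exact: holomorphicD (holomorphic_zeta F s) (holomorphic_zetaV F s).
Qed.

Lemma mx_holomorphic_WSW s : Fm (zeta F s) \in unitmx ->
  mx_holomorphic_at (WSW G lift w) s.
Proof.
move=> uF; apply: mx_holomorphicM; last exact: mx_holomorphic_cst.
apply: mx_holomorphicM; first exact: mx_holomorphic_cst.
apply: mx_holomorphicD; first exact: mx_holomorphic_cst.
apply: mx_holomorphicZ.
  apply: holomorphicM; last exact: holomorphic_cst.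
  exact: holomorphicD (holomorphic_zetaV F s) (holomorphicN (holomorphic_zeta F s)).
apply: mx_holomorphicM; last exact: mx_holomorphic_cst.
apply: mx_holomorphicM; first exact: mx_holomorphic_cst.
exact: (mx_holomorphicV (mx_holomorphic_Fmx s) uF).
Qed.

Lemma Whalf_unit : Whalf w \in unitmx.
Proof.
rewrite unitmxE unitfE det_diag; apply/prodf_neq0 => c _.
by rewrite mxE (fmorph_eq0 (real_complex R)) gt_eqF // sqrtr_gt0 (cd_width_gt0 cuspG).
Qed.

(** The square root of the weight contributes [a^-n], which cancels the [a^n] in
    [q^(ns) = a^n zeta^n] and in [q^(n(1-s)) = a^n zeta^-n]. *)
Lemma cusp_amplitudes s f (b p : 'cV[C]_r) : has_cusp_expansion F s f b p ->
  amplitudes (zeta F s) (Uop G lift f) (K_in F w (zeta F s) *m b) (K_out F w (zeta F s) *m p).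
Proof.
move=> fE c n n1; have a0 := sqrtq_neq0 R F; have z0 := zeta_neq0 F s.
rewrite /Uop (cd_weight cuspG) // fE // /psi_in /psi_out -c_in_zeta -c_out_zeta.
rewrite !qpow_natM.
have -> : qpow F s = a * zeta F s by rewrite zetaE mulrC divfK.
have -> : qpow F (1 - s) = a * (zeta F s)^-1.
  by rewrite -zeta_onem zetaE mulrC divfK.
rewrite /K_in /K_out /Whalf -!scalemxAl !mul_diag_mx !mxE.
have -> : Num.sqrt (w c * (#|F|.+1)%:R / #|F|%:R ^+ n) =
    Num.sqrt (w c) * Num.sqrt (#|F|.+1)%:R / Num.sqrt (#|F|%:R) ^+ n :> R.
  have q0 : 0 <= #|F|%:R :> R by rewrite ler0n.
  have w0 := ltW (cd_width_gt0 cuspG c).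
  apply: (@pexpIrn _ 2) => //; first by rewrite nnegrE sqrtr_ge0.
    by rewrite nnegrE !mulr_ge0 ?invr_ge0 ?exprn_ge0 ?sqrtr_ge0.
  rewrite sqr_sqrtr; last by rewrite !mulr_ge0 ?invr_ge0 ?exprn_ge0 ?ler0n.
  by rewrite !exprMn exprVn -exprM mulnC exprM !sqr_sqrtr.
rewrite !rmorphM fmorphV rmorphXn /= -[(Num.sqrt #|F|%:R)%:C]/a.
move: (zeta F s) z0 => z z0; rewrite !exprMn exprVn.
by field; rewrite !expf_neq0.
Qed.

End ScatteringMatrix.

(** * Unitarity and functional equation by continuation *)

Section Reflections.
Variable R : realType.
Local Notation C := (Cx R).
Implicit Types (f : C -> C) (z s : C) (P : set C).

Lemma near_continuous (g : C -> C) z P : {for z, continuous g} ->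
  (\forall w \near g z, P w) -> \forall w \near z, P (g w).
Proof. by move=> cg gP; exact: cg gP. Qed.

Lemma dnbhs_onem z P : (\forall w \near (1 - z)^', P w) -> \forall w \near z^', P (1 - w).
Proof.
have cf : {for z, continuous (fun w : C => 1 - w)}.
  exact: holomorphic_continuous (holomorphicD (holomorphic_cst 1 z)
    (holomorphicN (holomorphic_id z))).
rewrite /dnbhs /within /= => zP.
have : \forall w \near z, 1 - w != 1 - z -> P (1 - w) by exact: cf zP.
apply: filterS => w + wz; apply; apply: contra wz => /eqP e; apply/eqP.
by apply: oppr_inj; exact: addrI e.
Qed.

Lemma holomorphic_onem f z : holomorphic_at f (1 - z) -> holomorphic_at (fun w => f (1 - w)) z.
Proof.
have h1 (w : C) : holomorphic_at (fun w : C => 1 - w) w.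
  exact: holomorphicD (holomorphic_cst 1 w) (holomorphicN (holomorphic_id w)).
move=> fz; have := near_continuous (holomorphic_continuous (h1 z)) fz.
apply: filterS => w /derivable1_diffP dfw; apply/derivable1_diffP.
have dw : differentiable (fun w : C => 1 - w) w.
  exact: (derivable1_diffP _ _).1 (holomorphic_derivable (h1 w)).
exact: (differentiable_comp dw dfw).
Qed.

Lemma conj_continuous z : {for z, continuous (Num.conj : C -> C)}.
Proof.
move=> A /nbhs_ballP[e /= e0 eA]; apply/nbhs_ballP; exists e => // u zu.
by apply: eA; move: zu; rewrite /ball /= -rmorphB norm_conjC.
Qed.

(** The point [s] is a limit of other points of its vertical line. Continuity suffices, so this
    applies to expressions containing conjugates. *)
Lemma continuous_line_eq f s (c : C) : {for s, continuous f} ->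
  (\forall w \near s^', complex.Re w = complex.Re s -> f w = c) -> f s = c.
Proof.
move=> cf sf; apply/eqP; apply: contraT => fsc.
have H : \forall w \near s^', complex.Re w = complex.Re s -> false.
  apply: filterS2 (near_dnbhs (continuous_neq cf fsc)) sf => w fw sfw Rw.
  by move: fw; rewrite (sfw Rw) eqxx.
have /nbhs_ballP[e /= e0 He] : 
    nbhs s (fun w => w != s -> complex.Re w = complex.Re s -> false) := H.
have [k ek] : exists k : R, e = k%:C by exists (complex.Re e); rewrite RRe_real // gtr0_real.
have e2 : e / 2 = (k / 2)%:C by rewrite ek rmorphM fmorphV rmorph_nat.
have ei : 'i%C * (e / 2) != 0 :> C.
  rewrite mulf_neq0 //; last by rewrite mulf_neq0 ?invr_eq0 ?pnatr_eq0 // gt_eqF.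
  by rewrite complexiE neq0Ci.
(* A vertical displacement by half the radius stays in the ball and on the line. *)
apply: (He (s + 'i%C * (e / 2))).
- rewrite /ball /= opprD addNKr normrN normrM complexiE normCi mul1r.
  by rewrite gtr0_norm ?divr_gt0 // ltr_pdivrMr // ltr_pMr // ltr1n.
- by rewrite -subr_eq0 addrAC subrr add0r.
- by rewrite e2; case: (s) => x y /=; rewrite mul0r mulr0 subr0 addr0.
Qed.

Lemma continuous_sum_at (I : Type) (rI : seq I) (f : I -> C -> C) z :
  (forall i, {for z, continuous (f i)}) ->
  {for z, continuous (fun t => \sum_(i <- rI) f i t)}.
Proof.
move=> cf; elim: rI => [|i rI IHr].
  rewrite (_ : (fun t => _) = fun=> 0); first exact: cst_continuous.
  by apply/funext => t; rewrite big_nil.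
rewrite (_ : (fun t => _) = f i \+ (fun t => \sum_(i <- rI) f i t)).
  exact: (continuousD (cf i) IHr).
by apply/funext => t; rewrite big_cons.
Qed.

Lemma conj_line s : complex.Re s = 2^-1 -> Num.conj s = 1 - s.
Proof.
case: s => x y /= ->; apply/eqP; rewrite eq_complex; apply/andP; split; apply/eqP => /=.
  by field.
by rewrite sub0r.
Qed.

End Reflections.

(** * Unitarity for the weighted inner product and the functional equation *)

Section UnitaryContinuation.
Variables (R : realType) (r : nat) (w : 'I_r -> R).
Hypothesis w_gt0 : forall c, 0 < w c.
Local Notation C := (Cx R).

Definition Wdiag : 'M[C]_r := diag_mx (\row_c (w c)%:C).

Lemma Wdiag_unit : Wdiag \in unitmx.
Proof.
rewrite unitmxE unitfE det_diag; apply/prodf_neq0 => c _.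
by rewrite mxE (fmorph_eq0 (real_complex R)) gt_eqF.
Qed.

Lemma inner_WE (b1 b2 : 'cV[C]_r) :
  inner_W w b1 b2 = (adjoint b2 *m Wdiag *m b1) 0 0.
Proof.
rewrite mxE; apply: eq_bigr => c _; rewrite mul_mx_diag !mxE.
ring.
Qed.

Lemma unitary_WP (M : 'M[C]_r) : adjoint M *m Wdiag *m M = Wdiag -> unitary_W w M.
Proof.
move=> MW b1 b2; rewrite !inner_WE adjointM !mulmxA.
by rewrite -(mulmxA (adjoint b2)) -(mulmxA (adjoint b2)) MW.
Qed.

Lemma unitary_continuation (M : C -> 'M[C]_r) s : mx_is_continuation M ->
  mx_holomorphic_at M s -> complex.Re s = 2^-1 ->
  (\forall t \near s^', M (Num.conj t) = invmx Wdiag *m adjoint (M t) *m Wdiag) ->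
  (\forall t \near s^', M (1 - t) *m M t = 1%:M) ->
  unitary_W w (M s) /\ M (1 - s) *m M s = 1%:M.
Proof.
move=> cM hM Res refl funeq.
have MWM : adjoint (M s) *m Wdiag *m M s = Wdiag.
  apply/matrixP => i j; rewrite -[LHS]/((fun t => (adjoint (M t) *m Wdiag *m M t) i j) s).
  (* The adjoint is not holomorphic in [t], so the identity is carried to [s] along the line, where
     [conj t = 1 - t] merges the two hypotheses. *)
  apply: continuous_line_eq.
    have cMe k l : {for s, continuous (fun t => M t k l)} by exact: holomorphic_continuous.
    have cMc k l : {for s, continuous (fun t => Num.conj (M t k l))}.
      apply: (@continuous_comp _ _ _ (fun t => M t k l) (Num.conj : C -> C)); first exact: cMe.
      exact: conj_continuous.
    rewrite (_ : (fun t => _) = fun t =>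
      \sum_k (\sum_l Num.conj (M t l i) * Wdiag l k) * M t k j).
      apply: continuous_sum_at => k; apply: continuousM; last exact: cMe.
      apply: continuous_sum_at => l; apply: continuousM; first exact: cMc.
      exact: cst_continuous.
    apply/funext => t; rewrite mxE; apply: eq_bigr => k _; rewrite mxE; congr (_ * _).
    by apply: eq_bigr => l _; rewrite !mxE.
  apply: filterS2 refl funeq => t rt ft Ret.
  rewrite Res in Ret; rewrite (conj_line Ret) in rt.
  have := congr1 (mulmx Wdiag) ft; rewrite rt mulmx1 !mulmxA mulmxV ?Wdiag_unit // mul1mx.
  by move=> ->.
have uM : M s \in unitmx.
  have : adjoint (M s) *m Wdiag *m M s \in unitmx by rewrite MWM Wdiag_unit.
  by rewrite unitmx_mul => /andP[].
split; first exact: unitary_WP.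
(* Holomorphy of [M] at [1 - s] is not assumed: [N] supplies the holomorphic continuation there
   because [M s] is invertible. *)
pose N t := invmx (M (1 - t)).
have hN : mx_holomorphic_at N (1 - s).
  apply: mx_holomorphicV; last by rewrite opprB addrC subrK.
  move=> i j; apply: (@holomorphic_onem _ (fun t => M t i j)).
  by rewrite opprB addrC subrK; exact: hM.
have -> : M (1 - s) = N (1 - s).
  apply: mx_continuation_near_eq => //.
  have s1 : 1 - (1 - s) = s by rewrite opprB addrC subrK.
  have := @dnbhs_onem _ (1 - s) (fun t => M (1 - t) *m M t = 1%:M); rewrite s1 => /(_ funeq).
  apply: filterS => t; rewrite opprB [1 + _]addrC subrK /N => Mt.
  have [_ uMt] := mulmx1_unit Mt.
  by rewrite -[LHS](mulmxK uMt) Mt mul1mx.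
by rewrite /N opprB [1 + _]addrC subrK mulVmx.
Qed.

End UnitaryContinuation.

(** * Eisenstein series *)

Lemma near_forall2 (R : realType) m n (z : Cx R) (P : 'I_m -> 'I_n -> Cx R -> Prop) :
  (forall i j, \forall t \near z^', P i j t) -> \forall t \near z^', forall i j, P i j t.
Proof. by move=> zP; do 2!apply: filter_forall => ?; exact: zP. Qed.

Lemma near_dnbhs_and (R : realType) (z : Cx R) (P Q : Cx R -> Prop) :
  (\forall t \near z^', P t) -> (\forall t \near z^', Q t) ->
  \forall t \near z^', P t /\ Q t.
Proof. exact: filterI. Qed.

Lemma conjugate_mul1 (K : fieldType) n (W A B : 'M[K]_n) : W \in unitmx ->
  A *m B = 1%:M -> (invmx W *m A *m W) *m (invmx W *m B *m W) = 1%:M.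
Proof.
move=> uW AB; rewrite !mulmxA mulmxK // -(mulmxA _ A) AB mulmx1.
exact: mulVmx.
Qed.

Lemma conjugate_sqr (K : fieldType) n (W A : 'M[K]_n) : W \in unitmx ->
  invmx W *m A *m W = invmx (W *m W) *m (W *m (A *m invmx W)) *m (W *m W).
Proof.
move=> uW; have uWW : W *m W \in unitmx by rewrite unitmx_mul uW.
apply: (can_inj (mulKmx uWW)).
rewrite -[in RHS](mulmxA (invmx (W *m W))) (mulKVmx uWW).
by rewrite -!mulmxA (mulKVmx uW) (mulKmx uW).
Qed.

Section EisensteinSeries.
Variables (R : realType) (F : finFieldType) (d r : nat).
Variables (G : set 'M[laurent F]_2) (lift : qvert d r -> vclass F) (w : 'I_r -> R).
Variables (E : Cx R -> 'cV[Cx R]_r -> qvert d r -> Cx R) (Phi : Cx R -> 'M[Cx R]_r).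
Hypothesis pglG : pgl_subgroup G.
Hypothesis finG : forall x, tree_vertex x -> finite_set (@pgl_class F @` stab G x).
Hypothesis cuspG : cusp_decomposition G lift w.
Hypothesis eisE : is_eisenstein G lift E Phi.
Local Notation C := (Cx R).
Local Notation Fm := (@Fmx R F d r G lift).
Local Notation Sm := (@Smx R F d r G lift).
Local Notation cin s := (c_in F (zeta F s)).
Local Notation cout s := (c_out F (zeta F s)).
Local Notation wsw := (WSW G lift w).
Implicit Types (s t : C) (b : 'cV[C]_r).

(** Cross-multiplication keeps the scattering relation valid at the zeros of [c_in] and [c_out]; the
    common factor [sqrt(q + 1)] cancels. *)
Lemma eisenstein_WSW s b f p : Fm (zeta F s) \in unitmx ->
  eisenstein_solution G lift s b f p -> cout s *: p = cin s *: (wsw s *m b).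
Proof.
move=> uF [eigf expf].
have uW := Whalf_unit cuspG.
have k0 : (Num.sqrt (#|F|.+1)%:R : R)%:C != 0 :> C.
  by rewrite (fmorph_eq0 (real_complex R)) gt_eqF // sqrtr_gt0 ltr0n.
have eigf' v : adjacency G lift f v = xpar F (zeta F s) * f v by rewrite -xpar_zeta.
have := scattering_relation pglG finG cuspG (zeta_neq0 F s) uF eigf'
  (cusp_amplitudes cuspG expf).
rewrite /K_in /K_out -!scalemxAl -scalemxAr -!scalerA => /(scalerI k0) e.
apply: (can_inj (mulKmx uW)); rewrite -!scalemxAr e /WSW.
by rewrite -!mulmxA (mulKVmx uW).
Qed.

Lemma nonsingular_near s : \forall t \near s^', Fm (zeta F t) \in unitmx.
Proof.
have := @discrete_Fmx_singular R F d r G lift s.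
by apply: filterS => t /negP; rewrite negbK.
Qed.

Lemma c_in_neq0_near s : \forall t \near s^', cin t != 0.
Proof. by have := @discrete_c_in R F s; apply: filterS => t /eqP. Qed.

Lemma c_out_neq0_near s : \forall t \near s^', cout t != 0.
Proof. by have := @discrete_c_out R F s; apply: filterS => t /eqP. Qed.

Lemma solution_near s : \forall t \near s^',
  forall b, eisenstein_solution G lift t b (E t b) (Phi t *m b).
Proof.
have [D dD sol] := eis_solution eisE.
by have := dD s; apply: filterS => t /sol nD b; case: (nD b).
Qed.

Lemma Phi_near s : \forall t \near s^', cout t *: Phi t = cin t *: wsw t.
Proof.
apply: filterS2 (solution_near s) (nonsingular_near s) => t sol uF.
apply/matrixP => i j; have := eisenstein_WSW uF (sol (delta_mx j 0)).
by rewrite scalemxAl [RHS]scalemxAl -!colE => /colP/(_ i); rewrite !mxE.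
Qed.

(** The parameter [s] may lie in the exceptional set of [is_eisenstein]; the formula holds around
    it, and its holomorphic right-hand side determines the continued value. *)
Lemma PhiE s : Fm (zeta F s) \in unitmx -> cout s != 0 ->
  Phi s = (cin s / cout s) *: wsw s.
Proof.
move=> uF c0; pose N t := (cin t / cout t) *: wsw t.
rewrite -[RHS]/(N s); apply: (mx_continuation_near_eq (N := N) (eis_Phi eisE)).
  apply: mx_holomorphicZ; last exact: mx_holomorphic_WSW.
  exact: holomorphicM (holomorphic_c_in F s) (holomorphicV (holomorphic_c_out F s) c0).
apply: filterS2 (Phi_near s) (c_out_neq0_near s) => t Pt ct.
by rewrite /N mulrC -scalerA -Pt scalerA mulVf // scale1r.
Qed.

Lemma holomorphic_qpowM n (g : C -> C) s : holomorphic_at (fun t => qpow F (g t)) s ->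
  holomorphic_at (fun t => qpow F (n%:R * g t)) s.
Proof.
move=> hg; rewrite (_ : (fun t => _) = fun t => qpow F (g t) ^+ n).
  exact: holomorphicX.
by apply/funext => t; rewrite qpow_natM.
Qed.

Lemma holomorphic_qpow_onem s : holomorphic_at (fun t => qpow F (1 - t)) s.
Proof. exact: (holomorphic_onem (holomorphic_qpow F (1 - s))). Qed.

Lemma holomorphic_mulmx_col (M : C -> 'M[C]_r) b c s : mx_holomorphic_at M s ->
  holomorphic_at (fun t => (M t *m b) c 0) s.
Proof. by move=> hM; exact: (mx_holomorphicM hM (mx_holomorphic_cst b s) c 0). Qed.

(** The expansion holds off a discrete set; its right-hand side is holomorphic at [s], so it is the
    value that the continued [E] takes. *)
Lemma cusp_expansion s b : mx_holomorphic_at Phi s ->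
  has_cusp_expansion F s (E s b) b (Phi s *m b).
Proof.
move=> hPhi c n n1; have [_ cE] := eis_E eisE b (ray c n).
rewrite -[E s b _]/((fun t => E t b (ray c n)) s) -cE.
rewrite (@continuedE _ _ (fun t => b c 0 * (qpow F (n%:R * t) * cin t) +
  (Phi t *m b) c 0 * (qpow F (n%:R * (1 - t)) * cout t))).
- by rewrite c_in_zeta c_out_zeta.
- apply: holomorphicD; apply: holomorphicM.
  + exact: holomorphic_cst.
  + exact: holomorphicM (holomorphic_qpowM n (holomorphic_qpow F s)) (holomorphic_c_in F s).
  + exact: holomorphic_mulmx_col.
  + exact: holomorphicM (holomorphic_qpowM n (holomorphic_qpow_onem s)) (holomorphic_c_out F s).
- apply: filterS (solution_near s) => t /(_ b)[_ expE].
  by rewrite expE // /psi_in /psi_out -c_in_zeta -c_out_zeta.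
Qed.

Lemma amplitudes_unique (z : C) (g : qvert d r -> C) (p p' u u' : 'cV[C]_r) : z != 0 ->
  z ^+ 2 != 1 -> amplitudes z g p p' -> amplitudes z g u u' -> u = p /\ u' = p'.
Proof.
move=> z0 z1 gp gu.
have H c : u c 0 = p c 0 /\ u' c 0 = p' c 0.
  have := gp c 1%N isT; rewrite gu // !expr1 => e1.
  have := gp c 2%N isT; rewrite gu // => e2.
  have k0 : z - z^-1 != 0.
    rewrite subr_eq0; apply: contra z1 => /eqP zV.
    by rewrite expr2 {1}zV mulVf.
  have eu : u c 0 = p c 0.
    apply: (mulIf (mulf_neq0 z0 k0)); apply/eqP; rewrite -subr_eq0; apply/eqP.
    (* Subtracting [z^-1] times the equation at [n = 1] from the one at [n = 2] eliminates the
       outgoing amplitude. *)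
    have -> : u c 0 * (z * (z - z^-1)) - p c 0 * (z * (z - z^-1)) =
        ((u c 0 * z ^+ 2 + u' c 0 * z ^- 2) - (p c 0 * z ^+ 2 + p' c 0 * z ^- 2)) -
        z^-1 * ((u c 0 * z + u' c 0 / z) - (p c 0 * z + p' c 0 / z)).
      by field.
    by rewrite e1 e2 !subrr mulr0 subrr.
  split=> //; move: e1; rewrite eu => /addrI.
  by apply: mulIf; rewrite invr_eq0.
by split; apply/colP => c; case: (H c).
Qed.

Lemma meromorphic_ratio : meromorphic (fun s => cout s / cin s).
Proof.
apply: meromorphicM; last exact: meromorphic_c_inV.
by apply: holomorphic_meromorphic => s; exact: holomorphic_c_out.
Qed.

Lemma S_aut_continuation : mx_is_continuation (S_aut F Phi).
Proof.
move=> i j; pose f s : C := ((cout s / cin s) *: Phi s) i j.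
rewrite (_ : (fun s => _) = continued f); last by apply/funext => s; rewrite mxE.
apply: is_continuation_continued; rewrite /f.
rewrite (_ : (fun s => _) = fun s => cout s / cin s * Phi s i j).
  by apply: meromorphicM meromorphic_ratio _; case: (eis_Phi eisE i j).
by apply/funext => s; rewrite mxE.
Qed.

Lemma S_aut_near s : \forall t \near s^', S_aut F Phi t = (cout t / cin t) *: Phi t.
Proof.
have H i j : \forall t \near s^', S_aut F Phi t i j = ((cout t / cin t) *: Phi t) i j.
  pose f t : C := ((cout t / cin t) *: Phi t) i j.
  have mf : meromorphic f.
    rewrite (_ : f = fun s => cout s / cin s * Phi s i j).
      by apply: meromorphicM meromorphic_ratio _; case: (eis_Phi eisE i j).
    by apply/funext => t; rewrite /f mxE.
  by have := meromorphic_continued_near s mf; apply: filterS => t; rewrite [S_aut _ _ _ _ _]mxE.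
by have := near_forall2 H; apply: filterS => t Ht; apply/matrixP => i j.
Qed.

Lemma S_aut_Phi s : cin s != 0 -> mx_holomorphic_at Phi s ->
  S_aut F Phi s = (cout s / cin s) *: Phi s.
Proof.
move=> c0 hPhi; apply: (mx_continuation_near_eq S_aut_continuation _ (S_aut_near s)).
apply: mx_holomorphicZ => //.
exact: holomorphicM (holomorphic_c_out F s) (holomorphicV (holomorphic_c_in F s) c0).
Qed.

Lemma S_aut_WSW s : Fm (zeta F s) \in unitmx -> S_aut F Phi s = wsw s.
Proof.
move=> uF; apply: (mx_continuation_near_eq S_aut_continuation).
  exact: mx_holomorphic_WSW.
have H := near_dnbhs_and (S_aut_near s) (Phi_near s).
apply: filterS2 H (c_in_neq0_near s) => t [-> Pt] ct.
by rewrite mulrC -scalerA Pt scalerA mulVf // scale1r.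
Qed.

Lemma meromorphic_calE b v : meromorphic (fun s => E s b v * (cin s)^-1).
Proof. by apply: meromorphicM (@meromorphic_c_inV R F); case: (eis_E eisE b v). Qed.

(** Division by [c_in] turns [psi_in] into a pure power and leaves the factor [c_out / c_in] that
    [S_aut] absorbs; the identity then extends to [s] by continuation. *)
Lemma calE_expansion s b c n : mx_holomorphic_at (S_aut F Phi) s -> (1 <= n)%N ->
  calE F E s b (ray c n) =
  qpow F (n%:R * s) * b c 0 + qpow F (n%:R * (1 - s)) * (S_aut F Phi s *m b) c 0.
Proof.
move=> hS n1; rewrite /calE.
apply: (@continuedE _ _ (fun t => qpow F (n%:R * t) * b c 0 +
    qpow F (n%:R * (1 - t)) * (S_aut F Phi t *m b) c 0)).
  apply: holomorphicD; apply: holomorphicM.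
  - exact: holomorphic_qpowM (holomorphic_qpow F s).
  - exact: holomorphic_cst.
  - exact: holomorphic_qpowM (holomorphic_qpow_onem s).
  - exact: holomorphic_mulmx_col.
apply: filterS3 (solution_near s) (S_aut_near s) (c_in_neq0_near s) => t /(_ b)[_ expE] -> c0.
have -> : ((cout t / cin t) *: Phi t *m b) c 0 = cout t / cin t * (Phi t *m b) c 0.
  by rewrite -scalemxAl mxE.
rewrite (expE c n n1) /psi_in /psi_out -c_in_zeta -c_out_zeta.
by field.
Qed.

Lemma WSW_onem s : Fm (zeta F s) \in unitmx -> Fm (zeta F (1 - s)) \in unitmx ->
  wsw (1 - s) *m wsw s = 1%:M.
Proof.
rewrite zeta_onem => uF uF'; rewrite /WSW zeta_onem.
exact: conjugate_mul1 (Whalf_unit cuspG) (Smx_mulV (zeta_neq0 F s) uF uF').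
Qed.

Lemma conj_zeta s : Num.conj (zeta F s) = zeta F (Num.conj s).
Proof.
by rewrite /zeta conj_qpow rmorphB fmorphV rmorph_nat.
Qed.

Lemma Whalf_sqr : Whalf w *m Whalf w = Wdiag w.
Proof.
rewrite /Whalf mulmx_diag; congr diag_mx; apply/rowP => c; rewrite !mxE.
by rewrite -rmorphM /= -expr2 sqr_sqrtr // ltW // (cd_width_gt0 cuspG).
Qed.

Lemma adjoint_Whalf : adjoint (Whalf w) = Whalf w.
Proof.
rewrite /adjoint /Whalf tr_diag_mx map_diag_mx; congr diag_mx; apply/rowP => c.
by rewrite !mxE; exact: conj_realC.
Qed.

(** Conjugating the symmetry of [S] by [W^(1/2)] on both sides assembles the two half powers into
    the full weight matrix [W]. *)
Lemma WSW_conj s : wsw (Num.conj s) = invmx (Wdiag w) *m adjoint (wsw s) *m Wdiag w.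
Proof.
rewrite /WSW -conj_zeta -(adjoint_Smx pglG finG cuspG) !adjointM adjoint_inv adjoint_Whalf.
by rewrite -Whalf_sqr; exact: conjugate_sqr (Whalf_unit cuspG).
Qed.

Lemma conj_c_in s : Num.conj (cin s) = cin (Num.conj s).
Proof.
rewrite /c_in -conj_zeta rmorphB; congr (_ - _); first exact: conj_divq.
by rewrite -fmorphV; exact: conj_mulq.
Qed.

Lemma conj_c_out s : Num.conj (cout s) = cout (Num.conj s).
Proof.
rewrite /c_out -conj_zeta rmorphB; congr (_ - _); first exact: conj_mulq.
rewrite (_ : (Num.conj (zeta F s))^-1 = Num.conj (zeta F s)^-1); last by rewrite fmorphV.
exact: conj_divq.
Qed.

Lemma nonsingular_conj s : (Fm (zeta F (Num.conj s)) \in unitmx) = (Fm (zeta F s) \in unitmx).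
Proof. by rewrite -conj_zeta -(adjoint_Fmx pglG finG cuspG) /adjoint map_unitmx unitmx_tr. Qed.

Lemma Phi_conj t : Fm (zeta F t) \in unitmx -> cout t != 0 ->
  Phi (Num.conj t) = invmx (Wdiag w) *m adjoint (Phi t) *m Wdiag w.
Proof.
move=> uF ct.
have uF' : Fm (zeta F (Num.conj t)) \in unitmx by rewrite nonsingular_conj.
have ct' : cout (Num.conj t) != 0 by rewrite -conj_c_out conjC_eq0.
rewrite (PhiE uF' ct') (PhiE uF ct) adjointZ WSW_conj -conj_c_in -conj_c_out.
by rewrite -scalemxAr -scalemxAl rmorphM fmorphV.
Qed.

(** The scalar factor at [1 - t] is [c_out / c_in], the inverse of that at [t], so the identity
    reduces to the one for [S]. *)
Lemma Phi_onem t : Fm (zeta F t) \in unitmx -> Fm (zeta F (1 - t)) \in unitmx ->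
  cin t != 0 -> cout t != 0 -> Phi (1 - t) *m Phi t = 1%:M.
Proof.
move=> uF uF' ci co.
have cinE : cin (1 - t) = - cout t by rewrite zeta_onem c_inV ?zeta_neq0.
have coutE : cout (1 - t) = - cin t by rewrite zeta_onem c_outV ?zeta_neq0.
have co' : cout (1 - t) != 0 by rewrite coutE oppr_eq0.
rewrite (PhiE uF' co') (PhiE uF co) -scalemxAl -scalemxAr (WSW_onem uF uF') scalerA.
rewrite cinE coutE; move: (cin t) (cout t) ci co => x y x0 y0.
by rewrite invrN mulrNN mulrA divfK // mulfV // scale1r.
Qed.

Lemma unitary_Phi s : complex.Re s = 2^-1 -> mx_holomorphic_at Phi s ->
  unitary_W w (Phi s) /\ Phi (1 - s) *m Phi s = 1%:M.
Proof.
move=> Res hM; have w0 := cd_width_gt0 cuspG.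
have nF' := dnbhs_onem (nonsingular_near (1 - s)).
have nF := nonsingular_near s; have nin := c_in_neq0_near s; have nout := c_out_neq0_near s.
apply: (unitary_continuation w0 (eis_Phi eisE) hM Res).
  by apply: filterS2 nF nout => t; exact: Phi_conj.
have H := near_dnbhs_and nF nF'; apply: filterS3 H nin nout => t [uF uF'].
exact: Phi_onem.
Qed.

Lemma unitary_S_aut s : complex.Re s = 2^-1 -> mx_holomorphic_at (S_aut F Phi) s ->
  unitary_W w (S_aut F Phi s) /\ S_aut F Phi (1 - s) *m S_aut F Phi s = 1%:M.
Proof.
move=> Res hM; have w0 := cd_width_gt0 cuspG.
have nF' := dnbhs_onem (nonsingular_near (1 - s)); have nF := nonsingular_near s.
apply: (unitary_continuation w0 S_aut_continuation hM Res).
  apply: filterS nF => t uF.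
  have uF' : Fm (zeta F (Num.conj t)) \in unitmx by rewrite nonsingular_conj.
  by rewrite (S_aut_WSW uF) (S_aut_WSW uF') WSW_conj.
apply: filterS2 nF nF' => t uF uF'.
by rewrite (S_aut_WSW uF) (S_aut_WSW uF') (WSW_onem uF uF').
Qed.

End EisensteinSeries.

Theorem theorem2p21 (R : realType) (F : finFieldType)
    (G : set 'M[laurent F]_2) (d r : nat)
    (lift : qvert d r -> vclass F) (w : 'I_r -> R)
    (E : Cx R -> 'cV[Cx R]_r -> qvert d r -> Cx R) (Phi : Cx R -> 'M[Cx R]_r) :
  nonuniform_arithmetic_lattice R G ->
  (1 <= d)%N ->
  cusp_decomposition G lift w ->
  is_eisenstein G lift E Phi ->
  [/\
      forall s b, mx_holomorphic_at Phi s ->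
        let p := K_in F w (zeta F s) *m b in
        let p' := K_out F w (zeta F s) *m (Phi s *m b) in
        amplitudes (zeta F s) (Uop G lift (E s b)) p p' /\
        (zeta F s ^+ 2 != 1 -> forall u u',
           amplitudes (zeta F s) (Uop G lift (E s b)) u u' ->
           u = p /\ u' = p'),

      (forall s, Fmx G lift (zeta F s) \in unitmx -> c_out F (zeta F s) != 0 ->
         Phi s = (c_in F (zeta F s) / c_out F (zeta F s)) *: WSW G lift w s) /\
      mero_eq Phi (fun s =>
        (c_in F (zeta F s) / c_out F (zeta F s)) *: WSW G lift w s),

      [/\ forall b v, is_continuation (fun s => calE F E s b v),
          forall b v s, c_in F (zeta F s) != 0 ->
            holomorphic_at (fun s' => E s' b v) s ->
            calE F E s b v = E s b v * (c_in F (zeta F s))^-1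
        & forall s b c n, mx_holomorphic_at (S_aut F Phi) s -> (1 <= n)%N ->
            calE F E s b (ray c n) =
            qpow F (n%:R * s) * b c 0 +
            qpow F (n%:R * (1 - s)) * (S_aut F Phi s *m b) c 0],
      [/\ mx_is_continuation (S_aut F Phi),
          forall s, c_in F (zeta F s) != 0 -> mx_holomorphic_at Phi s ->
            S_aut F Phi s =
            (c_out F (zeta F s) / c_in F (zeta F s)) *: Phi s,
          forall s, Fmx G lift (zeta F s) \in unitmx ->
            S_aut F Phi s = WSW G lift w s
        & mero_eq (S_aut F Phi) (WSW G lift w)]
    &
      forall theta : R, 0 < theta < pi ->
        let s : Cx R := 2^-1 + 'i * (theta / ln #|F|%:R)%:C in
        (mx_holomorphic_at Phi s ->
           unitary_W w (Phi s) /\ Phi (1 - s) *m Phi s = 1%:M) /\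
        (mx_holomorphic_at (S_aut F Phi) s ->
           unitary_W w (S_aut F Phi s) /\
           S_aut F Phi (1 - s) *m S_aut F Phi s = 1%:M)].

Proof.
move=> [pglG [finG _ _] _] _ cuspG eisE.
split.
- move=> s b hPhi p p'.
  have amp : amplitudes (zeta F s) (Uop G lift (E s b)) p p'.
    exact: (cusp_amplitudes cuspG (cusp_expansion eisE b hPhi)).
  split=> // z1 u u'; exact: (amplitudes_unique (zeta_neq0 F s) z1 amp).
- split; first exact: PhiE pglG finG cuspG eisE.
  apply: (sub_discrete _ (discrete_setU (@discrete_Fmx_singular R F d r G lift)
    (@discrete_c_out R F))) => s /= ne.
  apply: contrapT => /not_orP[/negP uF /eqP c0]; apply: ne.
  by apply: (PhiE pglG finG cuspG eisE) => //; rewrite negbK in uF.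
- split.
  + by move=> b v; apply: is_continuation_continued; exact: meromorphic_calE eisE b v.
  + move=> b v s c0 hE; rewrite /calE.
    exact: (continued_id (holomorphicM hE (holomorphicV (holomorphic_c_in F s) c0))).
  + exact: calE_expansion eisE.
- split.
  + exact: S_aut_continuation eisE.
  + exact: S_aut_Phi eisE.
  + exact: S_aut_WSW pglG finG cuspG eisE.
  + apply: (sub_discrete _ (@discrete_Fmx_singular R F d r G lift)) => s /= ne.
    by apply/negP => uF; apply: ne; exact: (S_aut_WSW pglG finG cuspG eisE).
- move=> theta _ s.
  have Res : complex.Re s = 2^-1.
    (* The inverse in [R[i]] unfolds to the conjugate over the squared modulus, here
       [2 / 2 ^+ 2]. *)
    rewrite /s raddfD /= !(mul0r, mulr0, subr0, addr0) expr0n addr0.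
    by rewrite -[1 + 1]/(2%:R : R) expr2 invfM mulrA divff ?mul1r // pnatr_eq0.
  split; first exact: unitary_Phi pglG finG cuspG eisE s Res.
  exact: unitary_S_aut pglG finG cuspG eisE s Res.
Qed.
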